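(* Suppose that $\Omega$ admits a localizable homogeneous space $(\Omega,\varpi,\mathsf d)$. Let $\mathsf w$ be a doubling weight on $\Omega$, let $n$ be a positive integer, and let $\Xi$ be a maximal $\frac{\delta}{n}$-separated subset of $\Omega$. There is a $\delta_0>0$ such that for $0<\delta<\delta_0$ there exist positive numbers $\lambda_z$, $z\in\Xi$, so that $$\int_\Omega f(x)\,\mathsf w(x)\,\mathrm d\mathsf m(x)=\sum_{z\in\Xi}\lambda_z f(z)\qquad\text{for all } f\in\Pi_n(\Omega).$$ Moreover, $\lambda_z\ge c_1\,\mathsf w\big(B(z,\tfrac{\delta}{n})\big)$ for all $z\in\Xi$ and, if Assertion 4 (see context) holds, then $\lambda_z\sim\mathsf w\big(B(z,\tfrac{\delta}{n})\big)$ for all $z\in\Xi$.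
   Context: Setting. $\Omega$ is a domain in $\mathbb R^d$ (either a set with nonempty interior or an algebraic surface) equipped with a metric $\mathsf d$; $B(x,r)=\{y\in\Omega:\mathsf d(x,y)<r\}$. The Lebesgue measure $\mathsf m$ on $\Omega$ is assumed to be doubling, i.e. $\mathsf m(B(x,2r))\le c\,\mathsf m(B(x,r))$ for all $x\in\Omega$, $r>0$, and $\min_{x\in\Omega}\mathsf m(B(x,\varepsilon))\ge c_\varepsilon>0$ for each $\varepsilon>0$. A weight is a nonnegative integrable function $\mathsf w$ on $\Omega$, and $\mathsf w(E)=\int_E\mathsf w\,\mathrm d\mathsf m$. It is a doubling weight if there is $L>0$ with $\mathsf w(B(x,2r))\le L\,\mathsf w(B(x,r))$ for all $x\in\Omega$ and $r>0$. $\Pi_n(\Omega)$ is the space of polynomials of degree at most $n$ restricted to $\Omega$. $A\sim B$ means $c'A\le B\le cA$ with positive constants independent of $n$ and $z$. Let $\varpi$ be a weight with $\int_\Omega\varpi\,\mathrm d\mathsf m=1$ such that $\langle f,g\rangle_\varpi=\int_\Omega fg\,\varpi\,\mathrm d\mathsf m$ is an inner product on polynomials restricted to $\Omega$; $\mathcal V_n(\Omega,\varpi)$ is the space of polynomials in $\Pi_n(\Omega)$ orthogonal to $\Pi_{n-1}(\Omega)$, and $P_n(\varpi;\cdot,\cdot)$ is its reproducing kernel. A nonnegative $\widehat a\in C^\infty(\mathbb R)$ is an admissible cut-off function if either (a) $\operatorname{supp}\widehat a\subset[0,2]$ and $\widehat a(t)=1$ for $t\in[0,1]$ (as a function on $[0,\infty)$),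 or (b) $\operatorname{supp}\widehat a\subset[1/2,2]$. Put $L_n(\varpi;x,y)=\sum_{k=0}^\infty\widehat a(k/n)P_k(\varpi;x,y)$. $(\Omega,\varpi,\mathsf d)$ is called a localizable homogeneous space if $\varpi$ is a doubling weight and the following hold for admissible $\widehat a$ and all $n=1,2,\dots$, with constants independent of $n,x,y,x_1,x_2$: Assertion 1: for every $\kappa>0$ and $x,y\in\Omega$, $|L_n(\varpi;x,y)|\le \dfrac{c_\kappa}{\sqrt{\varpi(B(x,n^{-1}))}\sqrt{\varpi(B(y,n^{-1}))}\,(1+n\,\mathsf d(x,y))^\kappa}$. Assertion 2: for some $\delta_0<1$, for every $\kappa>0$, $0<\delta\le\delta_0$ and $x_1\in B(x_2,\frac{\delta}{n})$, $y\in\Omega$, $|L_n(\varpi;x_1,y)-L_n(\varpi;x_2,y)|\le \dfrac{c_\kappa\,n\,\mathsf d(x_1,x_2)}{\sqrt{\varpi(B(x_1,n^{-1}))}\sqrt{\varpi(B(x_2,n^{-1}))}\,(1+n\,\mathsf d(x_2,y))^\kappa}$. Assertion 3: for sufficiently large $\kappa>0$, $\displaystyle\int_\Omega\frac{\varpi(y)}{\varpi(B(y,n^{-1}))(1+n\,\mathsf d(x,y))^\kappa}\,\mathrm d\mathsf m(y)\le c$ for all $x\in\Omega$. Assertion 4: $\Omega$ is compact, and for each $n$ and each $x\in\Omega$ there is a nonnegative polynomial $T_x$ of degree at most $n$ such that (1) $T_x(x)=1$, $T_x(y)\ge\delta'>0$ for $y\in B(x,\frac1n)$ with $\delta'$ independent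 of $n$, and for each $\gamma>1$, $0\le T_x(y)\le c_\gamma(1+n\,\mathsf d(x,y))^{-\gamma}$ for $y\in\Omega$; (2) there is a polynomial $q_n$ such that $q_n(x)T_x(y)$ is a polynomial of degree at most $rn$ in the $x$-variable, for some positive integer $r$, and $c_1\le q_n(x)\le c_2$ for $x\in\Omega$ for some positive numbers $c_1,c_2$ (constants independent of $n$). A discrete set $\Xi\subset\Omega$ is $\varepsilon$-separated if $\mathsf d(x,y)\ge\varepsilon$ for all distinct $x,y\in\Xi$; it is maximal $\varepsilon$-separated if in addition there is a constant $c_d>1$ (fixed, independent of $\varepsilon$) such that $1\le\sum_{z\in\Xi}\chi_{B(z,\varepsilon)}(x)\le c_d$ for all $x\in\Omega$. *)

(* Defs.v *)
From HB Require Import structures.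
From mathcomp Require Import all_boot all_order all_algebra.
From mathcomp Require Import all_classical all_reals all_analysis.
From mathcomp Require mpoly.
Import (canonicals, coercions) mpoly.

Set Implicit Arguments.
Unset Strict Implicit.
Unset Printing Implicit Defensive.
Import Order.TTheory GRing.Theory Num.Theory.
Import numFieldNormedType.Exports.

Local Open Scope classical_set_scope.
Local Open Scope ring_scope.

(* The ambient space is R^(d+1), so that the dimension is at least one; its    *)
(* points are row vectors.                                                     *)

Section CoverOuterMeasure.
Local Open Scope ereal_scope.
Variables (R : realType) (T J : Type) (D : set J) (S : J -> set T) (v : J -> R).

Definition cover_outer (A : set T) : \bar R :=
  ereal_inf [set \sum_(k <oo) (v (c k))%:E
    | c in [set c : nat -> J | (forall k, D (c k)) /\
                               A `<=` \bigcup_k S (c k)]].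

Hypothesis v_ge0 : forall j, (0 <= v j)%R.

Lemma le_cover_outer : {homo cover_outer : A B / A `<=` B >-> A <= B}.
Proof.
move=> A B AB; apply/ereal_inf_le_tmp => x [c [Dc Bc] <-{x}].
by exists c => //; split => //; apply: subset_trans AB Bc.
Qed.

Lemma cover_outer_ge0 A : 0 <= cover_outer A.
Proof.
apply: le_ereal_inf_tmp => x [c _ <-{x}].
by apply: nneseries_ge0 => n _ _; rewrite lee_fin.
Qed.

Lemma cover_outer0 j0 : D j0 -> v j0 = 0%R -> cover_outer set0 = 0.
Proof.
move=> Dj0 v0; apply/eqP; rewrite eq_le cover_outer_ge0 andbT.
apply: ereal_inf_lbound; exists (fun=> j0); first by split.
by rewrite eseries0// => k _ _; rewrite v0.
Qed.

Lemma cover_outer_sigma_subadditive : sigma_subadditive cover_outer.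
Proof.
move=> A; have [[i ioo]|] := pselect (exists i, cover_outer (A i) = +oo).
  rewrite (eseries_pinfty _ _ ioo) ?leey// => n _.
  by rewrite -ltNye (lt_le_trans _ (cover_outer_ge0 _)).
rewrite -forallNE => Aoo.
suff add2e (e : {posnum R}) :
    cover_outer (\bigcup_n A n) <= \sum_(i <oo) cover_outer (A i) + e%:num%:E.
  by apply/lee_addgt0Pr => _/posnumP[].
rewrite (le_trans _ (epsilon_trick _ _ _))//; last first.
  by move=> n; exact: cover_outer_ge0.
pose P n (c : nat -> J) := ((forall k, D (c k)) /\ A n `<=` \bigcup_k S (c k)) /\
  \sum_(k <oo) (v (c k))%:E <= cover_outer (A n) + (e%:num / (2 ^ n.+1)%:R)%:E.
have [G PG] : {G : nat -> nat -> J & forall n, P n (G n)}.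
  apply: (@choice _ _ P) => n; rewrite /P /cover_outer.
  set X := (X in ereal_inf X); move infS : (ereal_inf X) => iS.
  case: iS infS => [r Sr|Soo|Soo].
  - have en1 : (0 < e%:num / (2 ^ n.+1)%:R)%R by [].
    have /(lb_ereal_inf_adherent en1) : ereal_inf X \is a fin_num by rewrite Sr.
    move=> [x [c cA cx] xS].
    by exists c; split => //; rewrite cx -Sr; exact/ltW.
  - by have := Aoo n; rewrite /cover_outer Soo.
  - suff : lbound X 0 by move/le_ereal_inf_tmp; rewrite Soo.
    by move=> /= _ [c _ <-]; apply: nneseries_ge0 => k _ _; rewrite lee_fin.
pose w (p : nat * nat) : \bar R := (v (G p.1 p.2))%:E.
have w_ge0 p : 0 <= w p by rewrite /w lee_fin.
apply: (@le_trans _ _ (\esum_(p in setT) w p)).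
  apply: ereal_inf_lbound => /=.
  have /card_esym/ppcard_eqP[f] := card_nat2.
  exists (fun k => G (f k).1 (f k).2).
    split => [i|t [n _ Ant]]; first exact: (PG (f i).1).1.1.
    have [k _ Sk] := (PG n).1.2 _ Ant.
    by exists (f^-1%FUN (n, k)) => //=; rewrite invK ?inE.
  rewrite -[LHS](_ : \sum_(k <oo) w (f k) = _)//.
  rewrite -(esum_pred_image w _ xpredT) ?[fun=> _]set_true//.
  by rewrite image_eq.
rewrite (_ : esum _ _ = \sum_(i <oo) \sum_(j <oo) w (i, j)); last first.
  rewrite (_ : setT = [set: nat] `*`` (fun=> [set: nat])); last first.
    by apply/seteqP; split.
  rewrite (eq_esum (b := fun p => w (p.1, p.2))); last by case.
  rewrite -(@esum_esum _ _ _ setT (fun=> setT) (fun i j => w (i, j)))//.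
  rewrite nneseries_esumT; last first.
    by move=> n; apply: nneseries_ge0 => k _ _; exact: w_ge0.
  by apply: eq_esum => i _; rewrite nneseries_esumT.
apply: lee_nneseries => n _; last exact: (PG n).2.
by move=> _; apply: nneseries_ge0.
Qed.

End CoverOuterMeasure.

Section Lebesgue.
Variables (R : realType) (d : nat).
Local Notation T := 'rV[R]_d.+1.

Definition box (ab : T * T) : set T :=
  [set x | forall i, ab.1 0 i <= x 0 i <= ab.2 0 i].

Definition box_volume (ab : T * T) : R :=
  \prod_i Num.max 0 (ab.2 0 i - ab.1 0 i).

Definition lebesgue_outer : set T -> \bar R := cover_outer setT box box_volume.

Lemma box_volume_ge0 ab : 0 <= box_volume ab.
Proof. by apply: prodr_ge0 => i _; rewrite le_max lexx. Qed.

Lemma lebesgue_outer0 : lebesgue_outer set0 = 0%E.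
Proof.
apply: (cover_outer0 _ box_volume_ge0 (j0 := (0, 0))) => //.
by rewrite /box_volume big_ord_recl/= subrr maxxx mul0r.
Qed.

HB.instance Definition _ := isOuterMeasure.Build R T lebesgue_outer
  lebesgue_outer0 (cover_outer_ge0 _ _ box_volume_ge0)
  (@le_cover_outer _ _ _ _ _ _)
  (cover_outer_sigma_subadditive _ _ box_volume_ge0).

End Lebesgue.

Section Hausdorff.
Variables (R : realType) (d : nat).
Local Notation T := 'rV[R]_d.+1.

Definition euclidean_dist (x y : T) : R :=
  Num.sqrt (\sum_i (x 0 i - y 0 i) ^+ 2).

(* Volume of the Euclidean unit ball of R^k. *)
Fixpoint unit_ball_volume (k : nat) : R :=
  match k with
  | 0 => 1
  | 1 => 2
  | (k'.+2 as k'') => 2 * pi / k''%:R * unit_ball_volume k'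
  end.

(* A pair (A, r) stands for a set A of diameter at most r; the infimum over    *)
(* such r recovers the diameter. The constant normalizes the k.+1-dimensional  *)
(* Hausdorff measure so that it is the usual surface area on surfaces of       *)
(* dimension k.+1.                                                             *)
Definition diam_le (e : R) : set (set T * R) :=
  [set Ar | 0 <= Ar.2 <= e /\
    forall x y, Ar.1 x -> Ar.1 y -> euclidean_dist x y <= Ar.2].

Definition hausdorff_gauge (k : nat) (Ar : set T * R) : R :=
  unit_ball_volume k.+1 * (Num.max 0 Ar.2 / 2) ^+ k.+1.

Definition hausdorff_pre (k : nat) (e : R) : set T -> \bar R :=
  cover_outer (diam_le e) fst (hausdorff_gauge k).

Definition hausdorff_outer (k : nat) (A : set T) : \bar R :=
  ereal_sup [set hausdorff_pre k e A | e in [set e : R | 0 < e]].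

Lemma unit_ball_volume_ge0 k : 0 <= unit_ball_volume k.
Proof.
elim/ltn_ind: k => -[|[|k]] IH //=.
by apply: mulr_ge0; [rewrite divr_ge0// mulr_ge0// pi_ge0|exact: IH].
Qed.

Lemma hausdorff_gauge_ge0 k Ar : 0 <= hausdorff_gauge k Ar.
Proof.
by rewrite mulr_ge0 ?unit_ball_volume_ge0// exprn_ge0// divr_ge0// le_max lexx.
Qed.

Lemma hausdorff_outer0 k : hausdorff_outer k set0 = 0%E.
Proof.
have H0 e : 0 < e -> hausdorff_pre k e set0 = 0%E.
  move=> e0; apply: (cover_outer0 _ (hausdorff_gauge_ge0 k) (j0 := (set0, 0))).
    by split => //=; rewrite lexx ltW.
  by rewrite /hausdorff_gauge/= maxxx mul0r expr0n mulr0.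
rewrite /hausdorff_outer (_ : image _ _ = [set 0%E]) ?ereal_sup1//.
apply/seteqP; split => [_ [e /= e0 <-]|_ ->]; first exact: H0.
by exists 1; [exact: ltr01|exact: (H0 1 ltr01)].
Qed.

Lemma hausdorff_outer_ge0 k A : (0 <= hausdorff_outer k A)%E.
Proof.
apply: (le_trans (cover_outer_ge0 (diam_le 1) fst (hausdorff_gauge_ge0 k) A)).
by apply: ereal_sup_ubound; exists 1 => //=; exact: ltr01.
Qed.

Lemma le_hausdorff_outer k :
  {homo hausdorff_outer k : A B / A `<=` B >-> (A <= B)%E}.
Proof.
move=> A B AB; apply: ge_ereal_sup => _ [e /= e0 <-].
apply: (le_trans (le_cover_outer _ _ _ AB)).
by apply: ereal_sup_ubound; exists e.
Qed.

Lemma hausdorff_outer_sigma_subadditive k :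
  sigma_subadditive (hausdorff_outer k).
Proof.
move=> F; apply: ge_ereal_sup => _ [e /= e0 <-].
apply: le_trans.
  exact: (cover_outer_sigma_subadditive _ _ (hausdorff_gauge_ge0 k)).
apply: lee_nneseries => n _.
  by move=> _; exact: (cover_outer_ge0 _ _ (hausdorff_gauge_ge0 k)).
by apply: ereal_sup_ubound; exists e.
Qed.

HB.instance Definition _ k := isOuterMeasure.Build R T (hausdorff_outer k)
  (hausdorff_outer0 k) (hausdorff_outer_ge0 k) (@le_hausdorff_outer k)
  (@hausdorff_outer_sigma_subadditive k).

End Hausdorff.

Section Space.
Variables (R : realType) (d : nat).
Local Notation T := 'rV[R]_d.+1.
Variables (Omega : set T) (mu : {outer_measure set T -> \bar R}).
Variable dist : T -> T -> R.

(* Functions on Omega are represented by functions on the whole of R^(d+1);    *)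
(* their values outside Omega are never used.                                  *)

(* Omega carries either the Lebesgue measure, or, when it lies on an algebraic *)
(* surface, the surface area, i.e. the k.+1-dimensional Hausdorff measure with *)
(* k.+1 < d.+1. The finiteness and positivity of the measure of the balls      *)
(* required below force k.+1 to be the dimension of Omega.                     *)
Definition domain_with_lebesgue_measure : Prop :=
  mu.-caratheodory Omega /\
  ((Omega° !=set0 /\ mu =1 @lebesgue_outer R d) \/
   (exists p : mpoly.mpoly d.+1 R,
      (1 < mpoly.msize p)%N /\
      (forall x, Omega x -> mpoly.meval (x 0) p = 0) /\
      exists k, (k < d)%N /\ mu =1 @hausdorff_outer R d k)).

(* The completed measure obtained from mu; its measurable sets are the         *)
(* Caratheodory measurable ones.                                               *)
Definition leb : {measure set (caratheodory_type mu) -> \bar R} :=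
  (mu : set (caratheodory_type mu) -> \bar R).

Definition is_metric : Prop :=
  [/\ forall x y, Omega x -> Omega y -> 0 <= dist x y,
      forall x y, Omega x -> Omega y -> (dist x y = 0 <-> x = y),
      forall x y, Omega x -> Omega y -> dist x y = dist y x &
      forall x y z, Omega x -> Omega y -> Omega z ->
        dist x z <= dist x y + dist y z].

Definition dball (x : T) (r : R) : set T :=
  [set y | Omega y /\ dist x y < r].

Record doubling_metric_domain : Prop := {
  dmd_domain : domain_with_lebesgue_measure ;
  dmd_metric : is_metric ;
  (* needed for the measures of balls to be meaningful *)
  dmd_ball_measurable : forall x r, Omega x -> mu.-caratheodory (dball x r) ;
  dmd_ball_finite : forall x r, Omega x -> 0 < r -> (leb (dball x r) < +oo)%E ;
  dmd_doubling : exists c : R, 0 < c /\ forall x r, Omega x -> 0 < r ->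
    (leb (dball x (2 * r)) <= c%:E * leb (dball x r))%E ;
  dmd_ball_lower : forall eps : R, 0 < eps -> exists c : R, 0 < c /\
    forall x, Omega x -> (c%:E <= leb (dball x eps))%E }.

Definition wmass (w : T -> R) (E : set T) : R := \int[leb]_(x in E) w x.

(* A weight is understood not to vanish almost everywhere: for w = 0 there are *)
(* no positive cubature weights.                                               *)
Definition weight (w : T -> R) : Prop :=
  [/\ forall x, Omega x -> 0 <= w x,
      leb.-integrable Omega (EFin \o w) &
      0 < wmass w Omega].

Definition doubling_weight (w : T -> R) : Prop :=
  weight w /\
  exists L : R, 0 < L /\ forall x r, Omega x -> 0 < r ->
    wmass w (dball x (2 * r)) <= L * wmass w (dball x r).

(* mpoly.msize is the total degree plus one (and 0 for the zero polynomial).   *)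
Definition Pi (n : nat) : set (T -> R) :=
  [set f | exists p : mpoly.mpoly d.+1 R, (mpoly.msize p <= n.+1)%N /\
    forall x, Omega x -> f x = mpoly.meval (x 0) p].

Section OrthogonalPolynomials.
Variable varpi : T -> R.

Definition inner (f g : T -> R) : R :=
  \int[leb]_(x in Omega) (f x * g x * varpi x).

Record orthogonality_weight : Prop := {
  ow_weight : weight varpi ;
  ow_normalized : wmass varpi Omega = 1 ;
  ow_integrable : forall m n f g, Pi m f -> Pi n g ->
    leb.-integrable Omega (fun x => (f x * g x * varpi x)%:E) ;
  ow_definite : forall n f, Pi n f -> inner f f = 0 ->
    forall x, Omega x -> f x = 0 }.

(* For n = 0 the orthogonality condition is void, i.e. Pi_(-1) = {0}.          *)
Definition V (n : nat) : set (T -> R) :=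
  [set f | Pi n f /\ forall k g, (k < n)%N -> Pi k g -> inner f g = 0].

Definition reproducing_kernel (n : nat) (K : T -> T -> R) : Prop :=
  (forall x, Omega x -> V n (K x)) /\
  (forall f x, V n f -> Omega x -> inner f (K x) = f x).

End OrthogonalPolynomials.

Definition smooth (a : R -> R) : Prop :=
  forall k t, derivable (derive1n k a) t 1.

(* Only the restriction of the cut-off to [0, +oo[ matters in the first case.  *)
Definition admissible (a : R -> R) : Prop :=
  [/\ smooth a, forall t, 0 <= a t &
      ((forall t, 0 <= t <= 1 -> a t = 1) /\ (forall t, 2 < t -> a t = 0)) \/
      (forall t, a t != 0 -> 2^-1 <= t <= 2)].

Section LocalizableSpace.
Variables (varpi : T -> R) (P : nat -> T -> T -> R).

Definition Lker (a : R -> R) (n : nat) (x y : T) : R :=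
  limn (series (fun k => a (k%:R / n%:R) * P k x y)).

Local Notation sqmass x n := (Num.sqrt (wmass varpi (dball x n%:R^-1))).

Definition assertion1 (a : R -> R) : Prop :=
  forall kappa : R, 0 < kappa -> exists c : R, 0 < c /\
  forall (n : nat) x y, (0 < n)%N -> Omega x -> Omega y ->
    `|Lker a n x y| <=
      c / (sqmass x n * sqmass y n * (1 + n%:R * dist x y) `^ kappa).

Definition assertion2 (a : R -> R) : Prop :=
  exists delta0 : R, 0 < delta0 < 1 /\
  forall kappa : R, 0 < kappa -> exists c : R, 0 < c /\
  forall (n : nat) (delta : R) x1 x2 y, (0 < n)%N -> 0 < delta <= delta0 ->
    Omega x2 -> dball x2 (delta / n%:R) x1 -> Omega y ->
    `|Lker a n x1 y - Lker a n x2 y| <=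
      c * n%:R * dist x1 x2 /
      (sqmass x1 n * sqmass x2 n * (1 + n%:R * dist x2 y) `^ kappa).

Definition assertion3 : Prop :=
  exists kappa0 : R, 0 < kappa0 /\
  forall kappa : R, kappa0 <= kappa -> exists c : R, 0 < c /\
  forall (n : nat) x, (0 < n)%N -> Omega x ->
    (\int[leb]_(y in Omega)
       (varpi y / (wmass varpi (dball y n%:R^-1) *
                   (1 + n%:R * dist x y) `^ kappa))%:E <= c%:E)%E.

Record localizable_homogeneous_space : Prop := {
  lhs_doubling : doubling_weight varpi ;
  lhs_assertion1 : forall a, admissible a -> assertion1 a ;
  lhs_assertion2 : forall a, admissible a -> assertion2 a ;
  lhs_assertion3 : assertion3 }.

End LocalizableSpace.

(* [fast n x] is the fast decreasing polynomial T_x of degree at most n; all    *)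
(* polynomials are restricted to Omega.                                        *)
Definition assertion4 : Prop :=
  compact Omega /\
  exists fast : nat -> T -> T -> R,
    [/\ forall n x, (0 < n)%N -> Omega x ->
          [/\ Pi n (fast n x), fast n x x = 1 &
              forall y, Omega y -> 0 <= fast n x y],
        exists delta' : R, 0 < delta' /\
          forall (n : nat) x y, (0 < n)%N -> Omega x ->
            dball x n%:R^-1 y -> delta' <= fast n x y,
        forall gamma : R, 1 < gamma -> exists c : R, 0 < c /\
          forall (n : nat) x y, (0 < n)%N -> Omega x -> Omega y ->
            fast n x y <= c * (1 + n%:R * dist x y) `^ (- gamma) &
        exists (r : nat) (c1 c2 : R) (q : nat -> T -> R),
          [/\ (0 < r)%N, 0 < c1, 0 < c2 &
              forall n, (0 < n)%N ->
                [/\ exists N, Pi N (q n),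
                    forall y, Omega y -> Pi (r * n) (fun x => q n x * fast n x y) &
                    forall x, Omega x -> c1 <= q n x <= c2]]].

Definition maximal_separated (cd eps : R) (Xi : set T) : Prop :=
  [/\ Xi `<=` Omega,
      forall x y, Xi x -> Xi y -> x <> y -> eps <= dist x y &
      forall x, Omega x ->
        (1 <= \esum_(z in Xi) ((\1_(dball z eps) x : R)%:E) <= cd%:E)%E].

End Space.

(* Main.v *)
Require Import Defs.
From mathcomp Require Import all_boot all_order all_algebra.
From mathcomp Require Import all_classical all_reals all_analysis.
From mathcomp Require Import measurable_realfun.
From mathcomp Require mpoly.
Import (canonicals, coercions) mpoly.
From mathcomp Require Import ring lra.

(** The kernel [L_n] of a cut-off equal to 1 on [[0, 1]] reproduces [Pi_n].
    With [f*(z) = sup_y |f y| / (1 + n d(z, y))^b], Assertion 2 therefore gives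
    [|f x - f z| <= C n d(x, z) f*(z)] for [d(x, z)] small compared to [1 / n].
    Applied at a fixed small scale [eta / n] this bounds [f*] by a weighted sum
    over a net of local [w]-averages of [|f|], hence, as [w] is doubling,
    [sum_(z in Xi) w(B(z, delta/n)) f*(z) <= C2 int |f| w] with [C2] independent
    of [delta]. Let [mu_z] be the integrals against [w] of the partition of
    unity subordinate to the balls [B(z, delta/n)]. Then [int f w] differs from
    [sum_z mu_z f(z)] by at most [C C2 delta int |f| w], so for small [delta]
    the functional [int f w - (1/2) sum_z mu_z f(z)] is nonnegative on the
    polynomials that are nonnegative on [Xi]. By Farkas' lemma it is a
    nonnegative combination of point evaluations, and
    [lambda_z >= mu_z / 2 >= w(B(z, delta/n)) / (2 c_d)]. The upper bound comes
    from the cubature formula for the fast decreasing polynomial centred at [z].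

    Polynomials are measurable because the balls are: a doubling weight of
    finite mass forces [Omega] to be totally bounded for [d], so that [d]-open
    sets are countable unions of balls, and by the oscillation bound polynomials
    are [d]-continuous. *)

Set Implicit Arguments.
Unset Strict Implicit.
Unset Printing Implicit Defensive.
Import Order.TTheory GRing.Theory Num.Theory.
Import numFieldNormedType.Exports.
Local Open Scope classical_set_scope.
Local Open Scope ring_scope.

(** * Farkas lemma and orthogonal projection *)

Section LinearAlgebra.
Variables (R : realFieldType) (V : lmodType R).

Definition lin_closed (S : set V) :=
  S 0 /\ forall (a : R) x y, S x -> S y -> S (a *: x + y).

Definition linear_on (S : set V) (b : V -> R) :=
  forall (a : R) x y, S x -> S y -> b (a *: x + y) = a * b x + b y.

Lemma linear_on0 S b : lin_closed S -> linear_on S b -> b 0 = 0.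
Proof.
by move=> [S0 _] /(_ 1 0 0 S0 S0); rewrite scaler0 add0r mul1r; lra.
Qed.

Lemma linear_onZ S b a x : lin_closed S -> linear_on S b -> S x ->
  b (a *: x) = a * b x.
Proof.
move=> cS lb Sx; rewrite -[a *: x]addr0 lb// ?(linear_on0 cS lb) ?addr0//.
by case: cS.
Qed.

Lemma lin_closedZ S a x : lin_closed S -> S x -> S (a *: x).
Proof. by move=> [S0 cS] Sx; rewrite -[a *: x]addr0; apply: cS. Qed.

(* Induction on the number of functionals: if [b] is not already a
   consequence of the first ones, a point violating this is used to eliminate
   the last. *)
Lemma farkas (I : eqType) (S : set V) (s : seq I) (a : I -> V -> R)
    (b : V -> R) :
  lin_closed S -> uniq s -> (forall i, linear_on S (a i)) -> linear_on S b ->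
  (forall x, S x -> (forall i, i \in s -> 0 <= a i x) -> 0 <= b x) ->
  exists lam : I -> R, (forall i, 0 <= lam i) /\
    forall x, S x -> b x = \sum_(i <- s) lam i * a i x.
Proof.
move=> cS; elim: s a b => [|i s IH] a b /=.
  move=> _ _ lb bge; exists (fun=> 0); split => // x Sx; rewrite big_nil.
  apply: le_anti; rewrite bge// andbT.
  have := bge (-1 *: x) (lin_closedZ _ cS Sx).
  by rewrite (linear_onZ _ cS lb Sx) mulN1r oppr_ge0; apply.
move=> /andP[Nis us] la lb bge.
have [ok|] := pselect (forall x, S x -> (forall j, j \in s -> 0 <= a j x)
  -> 0 <= b x).
  have [lam [lam0 blam]] := IH a b us la lb ok.
  exists (fun j => if j == i then 0 else lam j); split => [j|x Sx].
    by case: ifP.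
  rewrite big_cons eqxx mul0r add0r blam//; apply: eq_big_seq => j js.
  by case: eqVneq => // ji; rewrite -ji js in Nis.
move=> /existsNP[x0 /not_implyP[Sx0 /not_implyP[ax0 /negP]]].
rewrite -ltNge => bx0.
have aix0 : a i x0 < 0.
  rewrite ltNge; apply/negP => aix0; move: bx0; rewrite ltNge => /negP; apply.
  by apply: bge => // j; rewrite inE => /predU1P[->//|]; exact: ax0.
(* [t x] is chosen so that [t x *: x0 + x] lies in the kernel of [a i]; [a' j x] and [b' x] are the
   values of [a j] and [b] at that point. *)
pose t x := - (a i x / a i x0).
pose a' j x := a j x + t x * a j x0.
pose b' x := b x + t x * b x0.
have lt' (l : R) x y : S x -> S y -> t (l *: x + y) = l * t x + t y.
  by move=> Sx Sy; rewrite /t la// mulrDl -mulrA mulrN opprD.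
have [j l x y Sx Sy|l x y Sx Sy|x Sx a'x|lam [lam0 b'lam]] := IH a' b' us.
- by rewrite /a' lt'// la//; ring.
- by rewrite /b' lt'// lb//; ring.
- have -> : b' x = b (t x *: x0 + x) by rewrite lb// /b' addrC.
  apply: bge => [|j]; first by case: cS => _; apply.
  rewrite inE => /predU1P[->|js].
    by rewrite la// /t mulNr divfK ?lt_eqF// addNr.
  by rewrite la// addrC; exact: a'x.
(* Solving the identity for [b'] for [b] forces this coefficient of [a i]. It is nonnegative because
   numerator and denominator are both nonpositive. *)
pose mu := (b x0 - \sum_(j <- s) lam j * a j x0) / a i x0.
exists (fun j => if j == i then mu else lam j); split.
  move=> j; case: ifP => // _; rewrite /mu mulr_le0// ?invr_le0 ?(ltW aix0)//.
  rewrite subr_le0 (le_trans (ltW bx0))// big_seq sumr_ge0// => k ks.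
  by rewrite mulr_ge0// ax0.
move=> x Sx; rewrite big_cons eqxx.
rewrite (eq_big_seq (fun j => lam j * a j x)); last first.
  by move=> j js; case: eqVneq => // ji; rewrite -ji js in Nis.
have := b'lam x Sx; rewrite /b' /a'.
have -> : \sum_(j <- s) lam j * (a j x + t x * a j x0) =
    \sum_(j <- s) lam j * a j x + t x * \sum_(j <- s) lam j * a j x0.
  by rewrite mulr_sumr -big_split; apply: eq_bigr => j _ /=; ring.
move=> h; rewrite -[LHS](addrK (t x * b x0)) h /mu /t.
by field; rewrite lt_eqF.
Qed.

Fixpoint span (s : seq V) : set V :=
  if s is e :: s' then [set x | exists a y, span s' y /\ x = a *: e + y]
  else [set 0].

Lemma span_lin_closed s : lin_closed (span s).
Proof.
elim: s => [|e s [IH0 IH]] /=.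
  by split => // a x y -> ->; rewrite scaler0 addr0.
split; first by exists 0, 0; rewrite scale0r addr0.
move=> a x y [b [x' [x's ->]]] [c [y' [y's ->]]].
exists (a * b + c), (a *: x' + y'); split; first exact: IH.
by rewrite scalerDr scalerDl scalerA addrACA.
Qed.

Lemma sub_span (S : set V) s : lin_closed S -> (forall e, e \in s -> S e) ->
  span s `<=` S.
Proof.
move=> cS; elim: s => [_ x ->|e s IH sS x [a [y [ys ->]]]]; first by case: cS.
apply: (proj2 cS); first by apply: sS; rewrite mem_head.
by apply: IH ys => e' e's; apply: sS; rewrite inE e's orbT.
Qed.

Lemma big_span (I : Type) (s : seq I) (F : I -> V) (c : I -> R) :
  span (map F s) (\sum_(i <- s) c i *: F i).
Proof.
elim: s => [|i s IH]; first by rewrite big_nil.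
by rewrite big_cons /=; exists (c i), (\sum_(j <- s) c j *: F j).
Qed.

(** Gram-Schmidt, one vector of the list at a time. The form may be degenerate, as functions on the
    ambient space that vanish on the domain have norm zero; a vector of norm zero is only asked to
    be orthogonal to all of [S]. *)
Lemma orthogonal_projection (S : set V) (B : V -> V -> R) (s : seq V) :
  lin_closed S -> (forall x y, B x y = B y x) ->
  (forall x, S x -> linear_on S (B x)) ->
  (forall x, S x -> B x x = 0 -> forall y, S y -> B x y = 0) ->
  (forall e, e \in s -> S e) ->
  forall f, S f -> exists2 g, span s g & forall u, span s u -> B (f - g) u = 0.
Proof.
move=> cS BC lB dB.
have SB x y : S x -> S y -> S (x - y).
  by move=> Sx Sy; rewrite addrC -scaleN1r; apply: (proj2 cS).
have BBl x y z : S x -> S y -> S z -> B (x - y) z = B x z - B y z.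
  by move=> Sx Sy Sz; rewrite BC addrC -scaleN1r lB// mulN1r addrC BC (BC z y).
elim: s => [|e s IH] sS f Sf.
  exists 0 => // u ->; rewrite subr0.
  exact: (linear_on0 cS (lB _ Sf)).
have Se : S e by apply: sS; rewrite mem_head.
have {}sS e' : e' \in s -> S e' by move=> e's; apply: sS; rewrite inE e's orbT.
have spS := sub_span cS sS.
have [g gs fg] := IH sS f Sf; have [k ks ek] := IH sS e Se.
have [Sg Sk] := (spS _ gs, spS _ ks).
(* [h] is the component of the new vector orthogonal to the previous ones. If its norm is zero, the
   old projection [g] still works; otherwise [g] is corrected by the Fourier coefficient [t] along
   [h]. *)
set h := e - k in ek; have Sh : S h by exact: SB.
have [Bh0|Bh0] := eqVneq (B h h) 0.
  exists g => [|u [a [v [vs ->]]]].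
    by exists 0, g; rewrite scale0r add0r.
  have Sv := spS _ vs; have Sfg : S (f - g) by exact: SB.
  rewrite lB// (fg _ vs) addr0.
  suff -> : B (f - g) e = 0 by rewrite mulr0.
  have -> : e = 1 *: h + k by rewrite /h scale1r subrK.
  by rewrite lB// (fg _ ks) addr0 BC dB// mulr0.
pose t := B (f - g) h / B h h.
have Sth : S (t *: h) by exact: lin_closedZ.
exists (t *: e + (g - t *: k)).
  exists t, (g - t *: k); split => //.
  have := proj2 (span_lin_closed s) (- t) k g ks gs.
  by rewrite scaleNr addrC.
have -> : f - (t *: e + (g - t *: k)) = f - g - t *: h.
  by rewrite /h scalerBr !opprD !opprK !addrA [f - _ - _]addrAC.
have Sfg : S (f - g) by exact: SB.
have key u : span s u -> B (f - g - t *: h) u = 0.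
  move=> us; have Su := spS _ us.
  rewrite BBl// fg// sub0r BC (linear_onZ _ cS (lB _ Su))// BC ek// mulr0.
  by rewrite oppr0.
have keyh : B (f - g - t *: h) h = 0.
  rewrite BBl// (BC (t *: h)) (linear_onZ _ cS (lB _ Sh))// /t divfK ?subrr//.
move=> u [a [v [vs ->]]].
have Sx : S (f - g - t *: h) by exact: SB.
rewrite lB//; last exact: spS.
rewrite (key v)// addr0.
have -> : e = 1 *: h + k by rewrite /h scale1r subrK.
by rewrite lB// keyh key// mulr0 addr0 mulr0.
Qed.

End LinearAlgebra.

(** * A smooth cut-off *)

Section CutOff.
Variable R : realType.

(** The classical flat function [exp(-1/x)] for [k = 0]; the factors [x^-k] are those produced by
    differentiating it, so the family is stable under derivation up to linear combinations. *)
Definition flat (k : nat) (x : R) : R :=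
  if 0 < x then x^-1 ^+ k * expR (- x^-1) else 0.

Lemma flat_ge0 k x : 0 <= flat k x.
Proof.
rewrite /flat; case: ifPn => // x0.
by rewrite mulr_ge0 ?expR_ge0// exprn_ge0// invr_ge0 ltW.
Qed.

(** Keep the term of order [k + 2] in the exponential series at [1/x]. A quadratic bound is what
    makes the derivative at the origin vanish. *)
Lemma flat_le_sqr k x : flat k x <= (k.+2)`!%:R * x ^+ 2.
Proof.
rewrite /flat; case: ifPn => [x0|_]; last by rewrite mulr_ge0 ?sqr_ge0.
have y0 : 0 < x^-1 by rewrite invr_gt0.
have h := expR_ge1Dxn k.+1 (ltW y0).
have f0 : 0 < (k.+2)`!%:R :> R by rewrite ltr0n fact_gt0.
rewrite expRN ler_pdivrMr ?expR_gt0// mulrC -ler_pdivrMr; last first.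
  by rewrite mulr_gt0// exprn_gt0.
rewrite (le_trans _ h)//.
rewrite (_ : x^-1 ^+ k / (k.+2`!%:R * x ^+ 2) = x^-1 ^+ k.+2 / k.+2`!%:R).
  by rewrite lerDr.
rewrite !exprSr expr0 mul1r invfM -!mulrA invfM; congr (_ * _).
by rewrite mulrC -!mulrA.
Qed.

Lemma is_derive_flat k (x : R) :
  is_derive x 1 (flat k) (flat k.+2 x - k%:R * flat k.+1 x).
Proof.
have [x0|x0|->] := ltrgt0P x.
- have xn0 : x != 0 by rewrite gt_eqF.
  have dV := is_deriveV xn0 (is_derive_id x (1:R)).
  have dX := is_deriveX k dV.
  have dE := is_derive1_comp (is_derive_expR _) (is_deriveN dV).
  have dM := is_deriveM dX dE.
  apply: (@near_eq_is_derive _ _ _ _ (flat k) _ _ _ _ (is_derive_eq dM _)).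
    near=> y; rewrite fctE exprfctE /flat ifT//; near: y; exact: lt_nbhsr.
  rewrite exprfctE !fctE /flat !x0 /GRing.scale /= mulr1.
  case: k {dX dM} => [|k] /=; first by rewrite !expr0; field.
  by rewrite -(exprVn x 2) !exprS; ring.
- have E : {near x, (cst 0 : R -> R) =1 flat k}.
    near=> y; rewrite /flat ifF//; apply/negbTE; rewrite -leNgt ltW//.
    by near: y; exact: lt_nbhsl.
  apply: (near_eq_is_derive E).
  apply: (is_derive_eq (is_derive_cst _ _ _) _).
  by rewrite /flat ltNge ltW//= mulr0 subr0.
- have l0 : h^-1 *: ((flat k \o shift 0) (h *: (1 : R)) - flat k 0)
      @[h --> (0 : R)^'] --> (0 : R).
    apply/cvgrPdist_le => e e0; near=> h.
    have hn0 : h != 0 by near: h; exact: nbhs_dnbhs_neq.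
    rewrite sub0r normrN /= /GRing.scale /= mulr1 addr0.
    rewrite [flat k 0]/flat ltxx subr0 normrM normfV ler_pdivrMl ?normr_gt0//.
    rewrite (ger0_norm (flat_ge0 _ _)) (le_trans (flat_le_sqr _ _))//.
    rewrite -real_normK ?num_real// expr2 mulrCA ler_wpM2l//.
    have f0 : 0 < (k.+2)`!%:R :> R by rewrite ltr0n fact_gt0.
    rewrite -ler_pdivlMl//.
    near: h; apply: dnbhs0_le; rewrite mulr_gt0 ?invr_gt0//.
  rewrite [X in is_derive _ _ _ X](_ : _ = 0); last first.
    by rewrite /flat ltxx mulr0 subr0.
  apply: DeriveDef; first by apply/cvg_ex; exists 0.
  exact: cvg_lim l0.
Unshelve. all: by end_near. Qed.

(* Contains the cut-off below and is stable under derivation, so that all its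
   members are smooth. *)
Inductive flat_algebra : (R -> R) -> Prop :=
| fa_cst c : flat_algebra (cst c)
| fa_left k : flat_algebra (fun t => flat k (2 - t))
| fa_right k : flat_algebra (fun t => flat k (t - 1))
| fa_inv : flat_algebra (fun t => (flat 0 (2 - t) + flat 0 (t - 1))^-1)
| fa_add f g : flat_algebra f -> flat_algebra g -> flat_algebra (f + g)
| fa_mul f g : flat_algebra f -> flat_algebra g -> flat_algebra (f * g).

(** The arguments [2 - t] and [t - 1] add up to 1, so one of them is positive. Hence the denominator
    of the cut-off never vanishes. *)
Lemma flat_sum_gt0 t : 0 < flat 0 (2 - t) + flat 0 (t - 1).
Proof.
have flat_gt0 x : 0 < x -> 0 < flat 0 x.
  by move=> x0; rewrite /flat x0 mulr_gt0 ?expR_gt0.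
have [t2|t2] := ltP t 2.
  by rewrite ltr_pwDl ?flat_ge0// flat_gt0// subr_gt0.
rewrite ltr_wpDl ?flat_ge0// flat_gt0// subr_gt0 (lt_le_trans _ t2)//.
by rewrite ltr1n.
Qed.

Lemma flat_algebra_derive f : flat_algebra f ->
  exists2 g, flat_algebra g & forall t : R, is_derive t 1 f (g t).
Proof.
have dl k (t : R) : is_derive t 1 (fun t => flat k (2 - t))
    (- (flat k.+2 (2 - t) - k%:R * flat k.+1 (2 - t))).
  have dB : is_derive t 1 (fun t : R => 2 - t) (0 - 1).
    exact: (is_deriveB (is_derive_cst (2 : R) t 1) (is_derive_id t 1)).
  apply: (is_derive_eq (is_derive1_comp (is_derive_flat k _) dB)_).
  by rewrite sub0r mulrN1.
have dr k (t : R) : is_derive t 1 (fun t => flat k (t - 1))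
    (flat k.+2 (t - 1) - k%:R * flat k.+1 (t - 1)).
  have dB : is_derive t 1 (fun t : R => t - 1) (1 - 0).
    exact: (is_deriveB (is_derive_id t 1) (is_derive_cst (1 : R) t 1)).
  apply: (is_derive_eq (is_derive1_comp (is_derive_flat k _) dB)_).
  by rewrite subr0 mulr1.
elim=> [c|k|k||{}f g fS [f' f'S df] gS [g' g'S dg]|{}f g fS [f' f'S df] gS [g'
  g'S dg]].
- by exists (cst 0) => [|t]; [exact: fa_cst|exact: is_derive_cst].
- exists (cst (-1) * ((fun t => flat k.+2 (2 - t)) +
      cst (- k%:R) * (fun t => flat k.+1 (2 - t)))) => [|t].
    by do !constructor.
  by apply: (is_derive_eq (dl k t) _); rewrite !fctE mulN1r mulNr.
- exists ((fun t => flat k.+2 (t - 1)) +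
      cst (- k%:R) * (fun t => flat k.+1 (t - 1))) => [|t].
    by do !constructor.
  by apply: (is_derive_eq (dr k t) _); rewrite !fctE mulNr.
- pose i t := (flat 0 (2 - t) + flat 0 (t - 1))^-1.
  exists (cst (-1) * (i * i) * (cst (-1) * (fun t => flat 2 (2 - t)) +
      (fun t => flat 2 (t - 1)))) => [|t].
    by do !constructor.
  pose D t := flat 0 (2 - t) + flat 0 (t - 1).
  have n0 : D t != 0 by rewrite gt_eqF// flat_sum_gt0.
  have dD : is_derive t 1 D _ := is_deriveD (dl 0 t) (dr 0 t).
  apply: (is_derive_eq (is_deriveV n0 dD)).
  by rewrite !fctE /i /D /GRing.scale /= -exprVn expr2; ring.
- exists (f' + g') => [|t]; first by constructor.
  exact: is_deriveD (df t) (dg t).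
- exists (f * g' + g * f') => [|t]; first by do !constructor.
  exact: is_deriveM (df t) (dg t).
Qed.

Lemma smooth_flat_algebra f : flat_algebra f -> smooth f.
Proof.
move=> fS k t.
have {fS} : flat_algebra (derive1n k f).
  elim: k => [//|k /flat_algebra_derive[g gS dg]].
  rewrite derive1nS (_ : derive1 _ = g)//.
  by apply/funext => s; rewrite derive1E;
    exact: (@derive_val _ _ _ _ _ _ _ (dg s)).
by move=> /flat_algebra_derive[g _ dg];
  exact: (@ex_derive _ _ _ _ _ _ _ (dg t)).
Qed.

(** The usual smooth transition [u / (u + v)], where [u] vanishes from 2 on and [v] vanishes up to
    1. *)
Lemma exists_cutoff : exists a : R -> R, [/\ admissible a,
  forall t, t <= 1 -> a t = 1 & forall t, 2 < t -> a t = 0].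
Proof.
pose a : R -> R := (fun t => flat 0 (2 - t)) *
  (fun t => (flat 0 (2 - t) + flat 0 (t - 1))^-1).
have a1 t : t <= 1 -> a t = 1.
  move=> t1; rewrite /a fctE.
  have -> : flat 0 (t - 1) = 0 by rewrite /flat ifF// subr_gt0 ltNge t1.
  rewrite addr0 divff// gt_eqF// /flat ifT ?mulr_gt0 ?expR_gt0// subr_gt0.
  by rewrite (le_lt_trans t1)// ltr1n.
have a2 t : 2 < t -> a t = 0.
  by move=> t2; rewrite /a fctE /flat ifF ?mul0r// subr_gt0 ltNge ltW.
exists a; split => //; split.
- by apply: smooth_flat_algebra; do !constructor.
- by move=> t; rewrite /a fctE mulr_ge0 ?flat_ge0// invr_ge0 ltW// flat_sum_gt0.
- by left; split => // t /andP[_]; exact: a1.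
Qed.

End CutOff.

(** * Weighted integrals *)

Section WeightedIntegral.
Context {disp : measure_display} {T : measurableType disp} {R : realType}.
Variables (m : {measure set T -> \bar R}) (Om : set T) (w : T -> R).
Hypotheses (mOm : measurable Om) (w_ge0 : forall x, Om x -> 0 <= w x)
  (int_w : m.-integrable Om (EFin \o w)).

Definition wintegrable (f : T -> R) :=
  m.-integrable Om (EFin \o (fun x => f x * w x)).

Definition wint (f : T -> R) : R := \int[m]_(x in Om) (f x * w x).

(** A class closed under sums, products and absolute values, all of whose members are integrable
    against the weight. *)
Definition bounded_measurable (f : T -> R) :=
  measurable_fun Om f /\ exists M : R, forall x, Om x -> `|f x| <= M.

Lemma bounded_measurable_wintegrable f : bounded_measurable f -> wintegrable f.
Proof.
move=> [mf [M fM]].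
have := @integrableMr _ _ _ m Om mOm f (EFin \o w) mf _ int_w.
rewrite /wintegrable; apply.
exists M; split; first exact: num_real.
by move=> N MN x Om_x /=; rewrite (le_trans (fM _ Om_x))// ltW.
Qed.

Lemma bounded_measurable_cst c : bounded_measurable (fun=> c).
Proof. by split; [exact: measurable_cst|exists `|c|]. Qed.

Lemma bounded_measurable_indic A : measurable A ->
  bounded_measurable (\1_A : T -> R).
Proof.
move=> mA; split; first exact: measurable_indic.
by exists 1 => x _; rewrite indicE; case: (_ \in _); rewrite ?normr1 ?normr0.
Qed.

Lemma bounded_measurableM f g : bounded_measurable f -> bounded_measurable g ->
  bounded_measurable (fun x => f x * g x).
Proof.
move=> [mf [M fM]] [mg [N gN]]; split; first exact: measurable_funM.
by exists (M * N) => x Ox; rewrite normrM ler_pM// ?fM ?gN.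
Qed.

Lemma bounded_measurable_norm f : bounded_measurable f ->
  bounded_measurable (fun x => `|f x|).
Proof.
move=> [mf [M fM]]; split; first exact: measurableT_comp.
by exists M => x Ox; rewrite normr_id fM.
Qed.

Lemma bounded_measurableD f g : bounded_measurable f -> bounded_measurable g ->
  bounded_measurable (fun x => f x + g x).
Proof.
move=> [mf [M fM]] [mg [N gN]]; split; first exact: measurable_funD.
by exists (M + N) => x Ox; rewrite (le_trans (ler_normD _ _))// lerD// ?fM ?gN.
Qed.

Lemma bounded_measurable_sum (I : eqType) (s : seq I) (F : I -> T -> R) :
  (forall i, i \in s -> bounded_measurable (F i)) ->
  bounded_measurable (fun x => \sum_(i <- s) F i x).
Proof.
elim: s => [|i s IH] bF.
  by under eq_fun do rewrite big_nil; exact: bounded_measurable_cst.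
have [bFi bFs] : bounded_measurable (F i) /\ forall j, j \in s ->
  bounded_measurable (F j).
  by split => [|j js]; apply: bF; rewrite inE ?eqxx// js orbT.
by under eq_fun do rewrite big_cons; apply: bounded_measurableD => //;
  exact: IH.
Qed.

Lemma wintegrableD f g : wintegrable f -> wintegrable g ->
  wintegrable (fun x => f x + g x).
Proof.
move=> fi gi; have := integrableD mOm fi gi; apply: eq_integrable => // x _.
by rewrite /= -EFinD mulrDl.
Qed.

Lemma wintegrableZ c f : wintegrable f -> wintegrable (fun x => c * f x).
Proof.
move=> fi; have := integrableZl mOm c fi; apply: eq_integrable => // x _.
by rewrite /= -EFinM mulrA.
Qed.

Lemma wintegrable_norm f : wintegrable f -> wintegrable (fun x => `|f x|).
Proof.
move=> fi; have := integrable_norm fi; apply: eq_integrable => // x Ox.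
by rewrite /= normrM (ger0_norm (w_ge0 _))//; exact: set_mem.
Qed.

Lemma wintegrable_sum (I : eqType) (s : seq I) (F : I -> T -> R) :
  (forall i, i \in s -> wintegrable (F i)) ->
  wintegrable (fun x => \sum_(i <- s) F i x).
Proof.
elim: s => [|i s IH] iF.
  under eq_fun do rewrite big_nil.
  exact/bounded_measurable_wintegrable/bounded_measurable_cst.
have [iFi iFs] : wintegrable (F i) /\ forall j, j \in s -> wintegrable (F j).
  by split => [|j js]; apply: iF; rewrite inE ?eqxx// js orbT.
by under eq_fun do rewrite big_cons; apply: wintegrableD => //; exact: IH.
Qed.

Lemma wintD f g : wintegrable f -> wintegrable g ->
  wint (fun x => f x + g x) = wint f + wint g.
Proof.
by move=> fi gi; rewrite -RintegralD//; apply: eq_Rintegral => x _;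
  rewrite mulrDl.
Qed.

Lemma wintZ c f : wintegrable f -> wint (fun x => c * f x) = c * wint f.
Proof.
by move=> fi; rewrite -RintegralZl//; apply: eq_Rintegral => x _; rewrite mulrA.
Qed.

Lemma wint_sum (I : eqType) (s : seq I) (F : I -> T -> R) :
  (forall i, i \in s -> wintegrable (F i)) ->
  wint (fun x => \sum_(i <- s) F i x) = \sum_(i <- s) wint (F i).
Proof.
elim: s => [|i s IH] iF.
  rewrite big_nil /wint; under eq_Rintegral do rewrite big_nil mul0r.
  by rewrite Rintegral_cst ?mul0r.
have [iFi iFs] : wintegrable (F i) /\ forall j, j \in s -> wintegrable (F j).
  by split => [|j js]; apply: iF; rewrite inE ?eqxx// js orbT.
rewrite big_cons -IH// -wintD//; last exact: wintegrable_sum.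
by apply: eq_Rintegral => x _; rewrite big_cons.
Qed.

Lemma eq_wint f g : (forall x, Om x -> f x = g x) -> wint f = wint g.
Proof. by move=> fg; apply: eq_Rintegral => x /set_mem Ox; rewrite fg. Qed.

Lemma le_wint f g : wintegrable f -> wintegrable g ->
  (forall x, Om x -> f x <= g x) -> wint f <= wint g.
Proof.
by move=> fi gi fg; apply: le_Rintegral => // x Ox;
  rewrite ler_wpM2r ?w_ge0 ?fg.
Qed.

Lemma wint_ge0 f : (forall x, Om x -> 0 <= f x) -> 0 <= wint f.
Proof. by move=> f0; apply: Rintegral_ge0 => x Ox;
  rewrite mulr_ge0 ?w_ge0 ?f0. Qed.

Lemma le_norm_wint f : wintegrable f -> `|wint f| <= wint (fun x => `|f x|).
Proof.
move=> fi; rewrite (le_trans (le_normr_Rintegral mOm fi))//.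
rewrite (@eq_Rintegral _ _ _ _ _ (fun x => `|f x| * w x))// => x /set_mem Ox.
by rewrite normrM (ger0_norm (w_ge0 _)).
Qed.

Definition mass (A : set T) : R := \int[m]_(x in A) w x.

Lemma massE A : A `<=` Om -> mass A = wint (\1_A : T -> R).
Proof.
move=> AOm; rewrite /mass -[in LHS](setIidr AOm) Rintegral_mkcondr.
apply: eq_Rintegral => x _; rewrite patchE indicE.
by case: (x \in A); rewrite ?mul1r ?mul0r.
Qed.

Lemma mass_ge0 A : A `<=` Om -> 0 <= mass A.
Proof. by move=> AOm; apply: Rintegral_ge0 => x /AOm /w_ge0. Qed.

Lemma indic_wintegrable A : measurable A -> wintegrable (\1_A : T -> R).
Proof. by move=> mA;
  exact/bounded_measurable_wintegrable/bounded_measurable_indic. Qed.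

Lemma le_mass A B : measurable A -> measurable B -> A `<=` B -> B `<=` Om ->
  mass A <= mass B.
Proof.
move=> mA mB AB BO; rewrite !massE//; last exact: subset_trans BO.
apply: le_wint => [||x Ox]; [exact: indic_wintegrable..|].
rewrite !indicE ler_nat; case: (boolP (x \in A)) => // /set_mem /AB xB.
by rewrite mem_set.
Qed.

(** Monotone convergence: if every [F n] had mass at most [c], so would their union. *)
Lemma lt_mass_bigcup (F : nat -> set T) (c : R) :
  (forall n, measurable (F n)) -> {homo F : n k / (n <= k)%N >-> n `<=` k} ->
  \bigcup_n F n = Om -> c < mass Om -> exists n, c < mass (F n).
Proof.
move=> mF ndF FOm cOm; apply: contrapT => /forallNP h.
have FsOm n : F n `<=` Om by rewrite -FOm; exact: bigcup_sup.
have ndF' : nondecreasing_seq F by move=> n k nk; apply/subsetPset; exact: ndF.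
have mwF n : measurable_fun (F n) (EFin \o w).
  exact: measurable_funS (measurable_int _ int_w).
have wF n x : F n x -> (0 <= (EFin \o w) x)%E.
  by move=> /FsOm /w_ge0; rewrite /= lee_fin.
have : ((\int[m]_(x in Om) (w x)%:E) <= c%:E)%E.
  rewrite -[X in (\int[m]_(x in X) _)%E]FOm.
  have /cvg_lim <- // := @ge0_nondecreasing_set_cvg_integral _ _ _ _ _ m ndF'
    mF mwF wF.
  apply: lime_le.
    apply: ereal_nondecreasing_is_cvgn.
    exact: ge0_nondecreasing_set_nondecreasing_integral.
  apply: nearW => n; have /negP := h n; rewrite -leNgt /mass /Rintegral.
  rewrite -lee_fin fineK//; apply: integrable_fin_num => //.
  exact: integrableS int_w.
rewrite -[X in (X <= _)%E]fineK; last exact: integrable_fin_num int_w.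
by rewrite lee_fin leNgt => /negP; apply.
Qed.

End WeightedIntegral.

(** * Doubling weights *)

Section MetricDomain.
Context {disp : measure_display} {T : measurableType disp} {R : realType}.
Variables (Om : set T) (dist : T -> T -> R).

Definition gball (x : T) (r : R) : set T := [set y | Om y /\ dist x y < r].

(** Isolates what the measure-theoretic arguments use of the domain, over an arbitrary measurable
    type; it is instantiated below with the Caratheodory measurable sets. *)
Record measurable_metric : Prop := {
  mm_domain : measurable Om ;
  mm_ge0 : forall x y, Om x -> Om y -> 0 <= dist x y ;
  mm_refl : forall x, Om x -> dist x x = 0 ;
  mm_sym : forall x y, Om x -> Om y -> dist x y = dist y x ;
  mm_triangle : forall x y z, Om x -> Om y -> Om z ->
    dist x z <= dist x y + dist y z ;
  mm_ball : forall x r, Om x -> measurable (gball x r) }.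

Record doubling (m : {measure set T -> \bar R}) (w : T -> R) (L : R) : Prop := {
  db_ge0 : forall x, Om x -> 0 <= w x ;
  db_integrable : m.-integrable Om (EFin \o w) ;
  db_mass_gt0 : 0 < mass m w Om ;
  db_gt0 : 0 < L ;
  db_doubling : forall x r, Om x -> 0 < r ->
    mass m w (gball x (2 * r)) <= L * mass m w (gball x r) }.

Definition separated (rho : R) (s : seq T) : Prop :=
  [/\ uniq s, forall z, z \in s -> Om z &
    forall x y, x \in s -> y \in s -> x <> y -> rho <= dist x y].

Lemma gball_sub x r : gball x r `<=` Om. Proof. by move=> y []. Qed.

Lemma sub_gball x r r' : r <= r' -> gball x r `<=` gball x r'.
Proof. by move=> rr' y [Oy xy]; split => //; exact: lt_le_trans rr'. Qed.

Hypothesis mm : measurable_metric.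

Lemma sub_gball_shift x y r r' : Om x -> Om y -> dist x y + r <= r' ->
  gball y r `<=` gball x r'.
Proof.
move=> Ox Oy xyr z [Oz yz]; split => //.
by rewrite (le_lt_trans (mm_triangle mm Ox Oy Oz))// (lt_le_trans _ xyr)//
  ltrD2l.
Qed.

Lemma exists_pow2_ge (a : R) : exists k : nat, a <= 2 ^+ k.
Proof.
exists (Num.truncn `|a|).+1;
  rewrite (le_trans (ler_norm a))// (le_trans (ltW (truncnS_gt _)))//.
by rewrite -natrX ler_nat ltnW// ltn_expl.
Qed.

(** Balls of half the separation are pairwise disjoint, so at most one term of the sum survives at
    [y]. *)
Lemma separated_at_most_one rho s (c : T -> R) A y : 0 <= A -> Om y ->
  separated rho s -> (forall z, z \in s -> gball z (rho / 2) y -> c z <= A) ->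
  \sum_(z <- s) c z * \1_(gball z (rho / 2)) y <= A.
Proof.
move=> A0 Oy [us sO sep] cA.
have [[z zs zy]|no] := pselect (exists2 z, z \in s & gball z (rho / 2) y).
  rewrite (bigD1_seq z)//= indicE mem_set// mulr1 big_seq_cond big1 ?addr0;
    first exact: cA.
  move=> x /andP[xs /eqP xz]; rewrite indicE memNset ?mulr0// => xy.
  have [Oz Ox] := (sO _ zs, sO _ xs).
  have := sep _ _ xs zs xz; apply/negP; rewrite -ltNge.
  rewrite (le_lt_trans (mm_triangle mm Ox Oy Oz))// [ltRHS](splitr rho).
  by rewrite ltrD//; [case: xy|rewrite (mm_sym mm)//; case: zy].
rewrite big_seq big1// => z zs; rewrite indicE memNset ?mulr0// => zy.
by apply: no; exists z.
Qed.

Section DoublingWeight.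
Variables (m : {measure set T -> \bar R}) (w : T -> R) (L : R).
Hypothesis dw : doubling m w L.

Let mO := mm_domain mm.
Let w0 := db_ge0 dw.
Let iw := db_integrable dw.
Let L0 := db_gt0 dw.

Lemma mass_gball_mono x r y r' : Om x -> Om y -> gball x r `<=` gball y r' ->
  mass m w (gball x r) <= mass m w (gball y r').
Proof.
by move=> Ox Oy xy; apply: (le_mass mO w0 iw) => //;
  [exact: (mm_ball mm)..|exact: gball_sub].
Qed.

Lemma doubling_iter k x r : Om x -> 0 < r ->
  mass m w (gball x (2 ^+ k * r)) <= L ^+ k * mass m w (gball x r).
Proof.
move=> Ox r0; elim: k => [|k IH]; first by rewrite !expr0 !mul1r.
rewrite exprS -mulrA (le_trans (db_doubling dw Ox _))//.
  by rewrite mulr_gt0// exprn_gt0.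
by rewrite exprS -mulrA ler_wpM2l// ltW.
Qed.

Lemma gball_exhausts x c : Om x -> c < mass m w Om ->
  exists k : nat, c < mass m w (gball x k%:R).
Proof.
move=> Ox cO; apply: (lt_mass_bigcup mO w0 iw (F := fun k =>
  gball x k%:R)) => //.
- by move=> k; exact: (mm_ball mm).
- by move=> k l kl; apply: sub_gball; rewrite ler_nat.
- apply/seteqP; split => [y [k _ []]//|y Oy].
  exists (Num.truncn (dist x y)).+1 => //; split => //; exact: truncnS_gt.
Qed.

(** Some large ball about [x] has positive mass. A dyadic dilate of the given ball contains it, and
    doubling carries the positivity down. *)
Lemma mass_gball_gt0 x r : Om x -> 0 < r -> 0 < mass m w (gball x r).
Proof.
move=> Ox r0; have [k] := gball_exhausts Ox (db_mass_gt0 dw).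
have [l kl] := exists_pow2_ge (k%:R / r).
move=> Bk; have := lt_le_trans Bk (mass_gball_mono Ox Ox (sub_gball _)).
move=> /(_ (2 ^+ l * r)); rewrite -ler_pdivrMr// => /(_ kl) Bl.
have := lt_le_trans Bl (doubling_iter l Ox r0).
by rewrite pmulr_rgt0// exprn_gt0.
Qed.

Lemma nonempty_domain : exists x, Om x.
Proof.
apply: contrapT => /forallNP h; have := db_mass_gt0 dw.
rewrite (_ : Om = set0) ?/mass ?Rintegral_set0 ?ltxx//.
by apply/seteqP; split => // x /h.
Qed.

(* A far away ball of radius half its distance to a ball of almost full mass
   would by doubling carry a fixed fraction of the total mass. *)
Lemma doubling_bounded : exists2 D : R, 0 < D &
  forall x, Om x -> gball x D = Om.
Proof.
have [x0 Ox0] := nonempty_domain.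
set M := mass m w Om; have M0 : 0 < M := db_mass_gt0 dw.
have L20 : 0 < 1 + (L ^+ 2)^-1 by rewrite addr_gt0// invr_gt0 exprn_gt0.
(* The threshold is such that a ball exceeding it, together with a disjoint set carrying [L^-2] of
   its mass, would outweigh [M]. *)
have [|k Bk] := @gball_exhausts x0 (M / (1 + (L ^+ 2)^-1)) Ox0.
  by rewrite ltr_pdivrMr// ltr_pMr// ltrDl invr_gt0 exprn_gt0.
have k0 : (0 < k%:R :> R).
  rewrite lt_neqAle ler0n andbT; apply/eqP => k0; move: Bk.
  rewrite -k0 (_ : gball x0 0 = set0) /mass ?Rintegral_set0; last first.
    by apply/seteqP; split => // y [Oy]; rewrite ltNge (mm_ge0 mm).
  by rewrite ltNge ltW// divr_gt0.
have bd x : Om x -> dist x0 x < 2 * k%:R.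
  move=> Ox; rewrite ltNge; apply/negP => xk.
  set rh := dist x0 x in xk.
  have rh0 : 0 < rh by rewrite (lt_le_trans _ xk)// mulr_gt0.
  (* The two balls are disjoint because [k <= rh / 2]. *)
  have : mass m w (gball x0 k%:R) + mass m w (gball x (rh / 2)) <= M.
    rewrite !(massE _ _ (@gball_sub _ _)) -wintD//; last 2 first.
    - exact/(indic_wintegrable mO iw)/(mm_ball mm).
    - exact/(indic_wintegrable mO iw)/(mm_ball mm).
    rewrite /M (@massE _ _ _ m Om)//; apply: (le_wint mO w0).
    - by apply: wintegrableD => //;
      exact/(indic_wintegrable mO iw)/(mm_ball mm).
    - exact: (indic_wintegrable mO iw).
    - move=> y Oy; rewrite !indicE (mem_set Oy) -natrD ler_nat.
      have [/set_mem [_ y0]|] := boolP (y \in gball x0 _); last by move=> _;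
        rewrite add0n; case: (_ \in _).
      rewrite memNset// => -[_ yx].
      have := mm_triangle mm Ox0 Oy Ox; rewrite (mm_sym mm Oy Ox) -/rh.
      by apply/negP; rewrite -ltNge; lra.
  (* Two doublings give the ball of radius [2 * rh] about [x], which contains the ball about
     [x0]. *)
  have B2 : mass m w (gball x0 k%:R) <= L ^+ 2 * mass m w (gball x (rh / 2)).
    apply: le_trans (doubling_iter 2 Ox _); last by rewrite divr_gt0.
    apply: mass_gball_mono => //; apply: sub_gball_shift => //.
    by rewrite (mm_sym mm Ox Ox0) -/rh; lra.
  apply/negP; rewrite -ltNge.
  have : mass m w (gball x0 k%:R) / L ^+ 2 <= mass m w (gball x (rh / 2)).
    by rewrite ler_pdivrMr ?exprn_gt0// mulrC.
  move: Bk; rewrite ltr_pdivrMr// mulrDr mulr1 => ? ?; lra.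
exists (4 * k%:R); first by rewrite mulr_gt0.
move=> x Ox; apply/seteqP; split => [y []//|y Oy]; split => //.
have := mm_triangle mm Ox Ox0 Oy; rewrite (mm_sym mm Ox Ox0).
by move: (bd _ Ox) (bd _ Oy) => ? ? ?; lra.
Qed.

(** The domain being bounded, a number of doublings independent of the centre turns a ball of radius
    [r] into the whole domain. *)
Lemma mass_gball_lower_bound r : 0 < r ->
  exists2 c : R, 0 < c & forall x, Om x -> c <= mass m w (gball x r).
Proof.
move=> r0; have [D D0 DO] := doubling_bounded.
have [k Dk] := exists_pow2_ge (D / r).
have Lk : 0 < L ^+ k by rewrite exprn_gt0.
exists (mass m w Om / L ^+ k); first by rewrite divr_gt0// (db_mass_gt0 dw).
move=> x Ox; rewrite ler_pdivrMr// mulrC (le_trans _ (doubling_iter k Ox r0))//.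
rewrite -{1}(DO _ Ox); apply: mass_gball_mono => //; apply: sub_gball.
by rewrite -ler_pdivrMr.
Qed.

(* [1 / (1 + t)^b] is at most [2^(b+1)] times the sum of [2^(-jb)] over the
   dyadic radii [2^j > t]; integrating, doubling turns the sum into a
   geometric series. *)
Lemma decay_wint (b : nat) (r A : R) x g : 2 * L <= 2 ^+ b -> Om x -> 0 < r ->
  0 <= A -> wintegrable m Om w g ->
  (forall y, Om y -> g y <= A / (1 + dist x y / r) ^+ b) ->
  wint m Om w g <= A * 2 ^+ b.+1 * mass m w (gball x r).
Proof.
move=> Lb Ox r0 A0 gi gA.
have [D D0 DO] := doubling_bounded.
have [J DJ] := exists_pow2_ge (D / r).
have q0 : 0 < (2 ^+ b)^-1 :> R by rewrite invr_gt0 exprn_gt0.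
set q := (2 ^+ b)^-1 in q0.
pose F j : T -> R := fun y => A * 2 ^+ b * q ^+ j * \1_(gball x (2 ^+ j * r)) y.
have Fi j : wintegrable m Om w (F j).
  by apply: wintegrableZ => //; exact/(indic_wintegrable mO iw)/(mm_ball mm).
have F0 j y : 0 <= F j y.
  by rewrite /F !mulr_ge0// ?exprn_ge0// ?(ltW q0)// indicE.
have gF y : Om y -> g y <= \sum_(j <- iota 0 J.+1) F j y.
  move=> Oy; set t := dist x y / r.
  have t0 : 0 <= t by rewrite divr_ge0 ?(ltW r0)// (mm_ge0 mm).
  (* A dyadic radius just above [t]: the ball of index [j] contains [y], while [1 / (1 + t)] is
     still at most [2 / 2^j]. *)
  have [j jJ [tj jt]] : exists2 j, (j <= J)%N & t < 2 ^+ j /\ 2 ^+ j <= 2 * (1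
    + t).
    have : t < 2 ^+ J.
      rewrite (lt_le_trans _ DJ)// /t ltr_pM2r ?invr_gt0//.
      by have : Om y by []; rewrite -(DO _ Ox) => -[].
    elim: J {DJ} => [|J IH] tJ; first by exists 0%N => //; rewrite expr0;
      split => //; lra.
    have [/IH[j jJ h]|Jt] := ltP t (2 ^+ J); first by exists j => //;
      exact: leqW.
    by exists J.+1 => //; split => //; rewrite exprS; lra.
  apply: (@le_trans _ _ (F j y)).
    rewrite (le_trans (gA _ Oy))// -/t /F indicE mem_set; last first.
      by split => //; rewrite -ltr_pdivrMr.
    rewrite mulr1 -mulrA ler_wpM2l// /q exprVn -exprM mulnC exprM -expr_div_n.
    rewrite -exprVn lerXn2r// ?nnegrE ?divr_ge0 ?invr_ge0 ?exprn_ge0//;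
      first lra.
    by rewrite ler_pdivlMr ?exprn_gt0// ler_pdivrMl; lra.
  rewrite (bigD1_seq j) ?iota_uniq ?mem_iota//= lerDl sumr_ge0//.
apply: (@le_trans _ _ (\sum_(j <- iota 0 J.+1) A * 2 ^+ b * 2^-1 ^+ j *
    mass m w (gball x r))).
  apply: le_trans (le_wint mO w0 gi _ gF) _; first exact: wintegrable_sum.
  rewrite wint_sum//; apply: ler_sum => j _.
  rewrite wintZ//; last exact/(indic_wintegrable mO iw)/(mm_ball mm).
  rewrite -massE; last exact: gball_sub.
  have mB : 0 <= mass m w (gball x r) by apply: (mass_ge0 _ w0);
    exact: gball_sub.
  apply: (@le_trans _ _ (A * 2 ^+ b * q ^+ j * (L ^+ j * mass m w (gball x
    r)))).
    rewrite ler_wpM2l ?doubling_iter// !mulr_ge0 ?exprn_ge0// ltW//.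
  (* The choice of [b] means [q * L <= 1/2]: the decay beats the growth of the balls, leaving a
     geometric series with sum at most 2. *)
  rewrite mulrA ler_wpM2r// -!mulrA !ler_wpM2l// ?exprn_ge0// -exprMn.
  rewrite lerXn2r ?nnegrE ?mulr_ge0 ?(ltW q0) ?(ltW L0)//.
  by rewrite /q ler_pdivrMl ?exprn_gt0// ler_pdivlMr// mulrC.
rewrite -mulr_suml ler_wpM2r//; first by apply: (mass_ge0 _ w0);
  exact: gball_sub.
rewrite -mulr_sumr exprSr mulrA ler_wpM2l ?mulr_ge0 ?exprn_ge0//.
rewrite -[iota _ _]/(index_iota 0 J.+1) big_mkord.
elim: J.+1 => [|K IH]; first by rewrite big_ord0.
rewrite big_ord_recl expr0; under eq_bigr do rewrite /bump exprS.
by rewrite -mulr_sumr; lra.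
Qed.

Lemma gball_wintegrable rho s (c : T -> R) : separated rho s ->
  forall z, z \in s -> wintegrable m Om w (fun y =>
    c z * \1_(gball z (rho / 2)) y).
Proof.
move=> [_ sO _] z zs; apply: wintegrableZ => //.
exact/(indic_wintegrable mO iw)/(mm_ball mm)/sO.
Qed.

Lemma wint_separated_sum rho s (c : T -> R) : separated rho s ->
  wint m Om w (fun y => \sum_(z <- s) c z * \1_(gball z (rho / 2)) y) =
  \sum_(z <- s) c z * mass m w (gball z (rho / 2)).
Proof.
move=> sep; have [us sO _] := sep.
rewrite wint_sum//; last exact: gball_wintegrable.
apply: eq_big_seq => z zs; rewrite wintZ//; last first.
  exact/(indic_wintegrable mO iw)/(mm_ball mm)/sO.
by rewrite (@massE _ _ _ m Om)//; exact: gball_sub.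
Qed.

Lemma separated_mass_le rho s : separated rho s ->
  \sum_(z <- s) mass m w (gball z (rho / 2)) <= mass m w Om.
Proof.
move=> sep; rewrite (eq_bigr _ (fun _ _ => esym (mul1r _))).
rewrite -(wint_separated_sum (fun=> 1))// (@massE _ _ _ m Om)//;
  apply: (le_wint mO w0).
- by apply: wintegrable_sum => //; exact: (@gball_wintegrable _ _ (fun=> 1)).
- exact: (indic_wintegrable mO iw).
- move=> y Oy; rewrite indicE mem_set//.
  exact: (@separated_at_most_one _ _ (fun=> 1)).
Qed.

(** The half balls are disjoint and each carries at least a fixed mass [c], while the total mass is
    finite. *)
Lemma separated_size rho : 0 < rho ->
  exists N : nat, forall s, separated rho s -> (size s <= N)%N.
Proof.
move=> rho0; have [|c c0 cB] := @mass_gball_lower_bound (rho / 2).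
  by rewrite divr_gt0.
exists (Num.truncn (mass m w Om / c)).+1 => s sep; have [us sO _] := sep.
rewrite -(ler_nat R) (le_trans _ (ltW (truncnS_gt _)))// ler_pdivlMr//.
rewrite (le_trans _ (separated_mass_le sep))//.
have -> : (size s)%:R * c = \sum_(z <- s) c.
  by rewrite big_const_seq count_predT iter_addr_0 mulr_natl.
by rewrite big_seq [leRHS]big_seq; apply: ler_sum => z zs; apply/cB/sO.
Qed.

(** A separated list of maximal length is a net: any point left uncovered could be added to it. *)
Lemma exists_net rho : 0 < rho -> exists2 s, separated rho s &
  forall x, Om x -> exists2 z, z \in s & dist z x < rho.
Proof.
move=> rho0; have [N sN] := separated_size rho0.
have ex : exists n, `[< exists2 s, separated rho s & size s = n >].
  by exists 0%N; apply/asboolP; exists [::].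
have ub n : `[< exists2 s, separated rho s & size s = n >] -> (n <= N)%N.
  by move=> /asboolP[s /sN + <-].
case: (ex_maxnP ex ub) => n /asboolP[s sep sn] max.
exists s => // x Ox; apply: contrapT => no.
have [us sO far] := sep.
have farx z : z \in s -> rho <= dist z x.
  by move=> zs; rewrite leNgt; apply/negP => zx; apply: no; exists z.
suff /max : `[< exists2 s, separated rho s & size s = n.+1 >] by rewrite ltnn.
apply/asboolP; exists (x :: s); last by rewrite /= sn.
split => /=.
- rewrite us andbT; apply/negP => /farx; rewrite (mm_refl mm)//.
  by rewrite leNgt rho0.
- by move=> z; rewrite inE => /predU1P[->//|/sO].
- move=> y z; rewrite !inE => /predU1P[->|ys] /predU1P[->|zs]//.
  + by move=> _; rewrite (mm_sym mm)//; [exact: farx|exact: sO].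
  + by move=> _; exact: farx.
  + exact: far.
Qed.

Lemma separated_set_finite rho (Xi : set T) : 0 < rho -> Xi `<=` Om ->
  (forall x y, Xi x -> Xi y -> x <> y -> rho <= dist x y) -> finite_set Xi.
Proof.
move=> rho0 XO sep; have [N sN] := separated_size rho0.
apply: contrapT => /(infinite_set_fset N.+1)[A AX].
rewrite leqNgt => /negP; apply; rewrite ltnS; apply: sN.
split => [|z zA|x y xA yA]; first exact: finmap.fset_uniq.
  by apply/XO/AX.
by apply: sep; exact: AX.
Qed.

(** [U] is the union over [k] of those balls of radius [1 / (k + 1)] about a finite net of that mesh
    which lie inside [U]. *)
Lemma open_measurable (U : set T) : U `<=` Om ->
  (forall x, U x -> exists2 r, 0 < r & gball x r `<=` U) -> measurable U.
Proof.
move=> UO oU.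
have pos k : 0 < (k.+1%:R)^-1 :> R by rewrite invr_gt0.
have /choice[net /all_and2[nsep ncov]] : forall k, exists s,
    separated (k.+1%:R)^-1 s /\ forall x, Om x ->
      exists2 z, z \in s & dist z x < (k.+1%:R)^-1.
  by move=> k; have [s ? ?] := exists_net (pos k); exists s.
pose B k z := if `[< gball z (k.+1%:R)^-1 `<=` U >] then gball z (k.+1%:R)^-1
  else set0.
rewrite (_ : U = \bigcup_k \big[setU/set0]_(z <- net k) B k z).
  apply: bigcupT_measurable => k; rewrite big_seq;
    apply: bigsetU_measurable => z zk.
  rewrite /B; case: ifP => // _; apply: (mm_ball mm).
  by have [_ + _] := nsep k; exact.
apply/seteqP; split => [x Ux|x [k _]].
  have [r r0 xr] := oU _ Ux; have Ox := UO _ Ux.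
  have [k kr] : exists k, (k.+1%:R)^-1 <= r / 2.
    exists (Num.truncn (r / 2)^-1);
      rewrite -[leRHS]invrK lef_pV2 ?posrE ?invr_gt0 ?divr_gt0//.
    exact/ltW/truncnS_gt.
  exists k => //; have [z zk zx] := ncov k _ Ox.
  have Oz : Om z by have [_ + _] := nsep k; exact.
  rewrite -bigcup_seq; exists z => //=; rewrite /B ifT; first by split.
  apply/asboolP; apply: subset_trans xr; apply: sub_gball_shift => //.
  by rewrite (mm_sym mm Ox Oz) [leRHS](splitr r) lerD// (le_trans (ltW zx)).
rewrite -bigcup_seq => -[z /= zk]; rewrite /B; case: ifP => // /asboolP; exact.
Qed.

(** The sets where [f > c] are open for [dist], hence measurable, and such half-lines generate the
    Borel sets. *)
Lemma lipschitz_measurable (f : T -> R) (K eta : R) : 0 < eta ->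
  (forall x z, Om x -> Om z -> dist z x < eta ->
    `|f x - f z| <= K * dist z x) ->
  measurable_fun Om f.
Proof.
move=> eta0 fK _; apply: (measurability _ (RGenOInfty.measurableE R)) => //.
move=> /= _ [_ [c ->] <-]; apply: open_measurable => [x []//|z [Oz]].
rewrite /= in_itv/= andbT => cz.
pose K' := `|K| + 1; have K'0 : 0 < K' by rewrite ltr_wpDl.
exists (Num.min eta ((f z - c) / K')).
  by rewrite lt_min eta0 divr_gt0// subr_gt0.
move=> x [Ox]; rewrite lt_min => /andP[zx zxK]; split => //=.
rewrite in_itv/= andbT.
have := fK _ _ Ox Oz zx; rewrite ler_norml => /andP[+ _].
move: zxK; rewrite ltr_pdivlMr// /K'.
have d0 := mm_ge0 mm Oz Ox.
have : K * dist z x <= `|K| * dist z x by rewrite ler_wpM2r// ler_norm.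
by rewrite mulrDr mulr1 (mulrC (dist z x)); lra.
Qed.

End DoublingWeight.
End MetricDomain.

(** * Marcinkiewicz-Zygmund inequality *)

Section PeetreMaximalFunction.
Context {disp : measure_display} {T : measurableType disp} {R : realType}.
Variables (Om : set T) (dist : T -> T -> R).
Hypothesis mm : measurable_metric Om dist.
Variables (b : nat) (r : R).
Hypothesis r0 : 0 < r.

Definition decay (x y : T) : R := (1 + dist x y / r) ^+ b.

(** Peetre's maximal function at scale [r]: it dominates [|f|] everywhere up to the factor [decay],
    yet varies slowly. *)
Definition fstar (f : T -> R) (z : T) : R :=
  sup [set `|f y| / decay z y | y in Om].

(* The modulus of continuity enjoyed by polynomials at scale [r], the inverse
   of the degree. *)
Definition oscillation_bound (C eta : R) (f : T -> R) : Prop :=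
  forall x z, Om x -> Om z -> dist z x < eta * r ->
    `|f x - f z| <= C * (dist z x / r) * fstar f z.

Lemma decay_ge1 x y : Om x -> Om y -> 1 <= decay x y.
Proof.
by move=> Ox Oy; rewrite exprn_ege1// lerDl divr_ge0 ?(mm_ge0 mm)// ltW.
Qed.

Lemma decay_gt0 x y : Om x -> Om y -> 0 < decay x y.
Proof. by move=> Ox Oy; rewrite (lt_le_trans ltr01)// decay_ge1. Qed.

Lemma decay_sym x y : Om x -> Om y -> decay x y = decay y x.
Proof. by move=> Ox Oy; rewrite /decay (mm_sym mm). Qed.

(** The triangle inequality and [1 + u + v <= (1 + u) * (1 + v)]. *)
Lemma decay_mul x y z : Om x -> Om y -> Om z ->
  decay x z <= decay x y * decay y z.
Proof.
move=> Ox Oy Oz; rewrite /decay -exprMn.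
have d0 u v : Om u -> Om v -> 0 <= dist u v / r.
  by move=> Ou Ov; rewrite divr_ge0 ?(mm_ge0 mm)// ltW.
have := d0 _ _ Ox Oy; have := d0 _ _ Oy Oz; have := d0 _ _ Ox Oz => h1 h2 h3.
rewrite lerXn2r// ?nnegrE; [lra|nra|].
have : dist x z / r <= dist x y / r + dist y z / r.
  by rewrite -mulrDl ler_pM2r ?invr_gt0// (mm_triangle mm).
nra.
Qed.

Lemma decay_near x y z : Om x -> Om y -> Om z -> dist y z <= r ->
  decay x z <= 2 ^+ b * decay x y.
Proof.
move=> Ox Oy Oz yz; rewrite (le_trans (decay_mul Ox Oy Oz))// mulrC.
rewrite ler_wpM2r ?(ltW (decay_gt0 _ _))// lerXn2r ?nnegrE//.
  by rewrite addr_ge0// divr_ge0 ?(mm_ge0 mm)// ltW.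
by rewrite -[leRHS]/(1 + 1) lerD2l ler_pdivrMr// mul1r.
Qed.

Section Function.
Variables (f : T -> R) (M : R).
Hypothesis fM : forall x, Om x -> `|f x| <= M.

Lemma fstar_has_ubound z :
  Om z -> has_ubound [set `|f y| / decay z y | y in Om].
Proof.
move=> Oz; exists M => _ [y Oy <-]; rewrite ler_pdivrMr ?decay_gt0//.
by rewrite (le_trans (fM Oy))// ler_peMr ?decay_ge1// (le_trans _ (fM Oy)).
Qed.

Lemma le_fstar y z : Om y -> Om z -> `|f y| <= fstar f z * decay z y.
Proof.
move=> Oy Oz; rewrite -ler_pdivrMr ?decay_gt0//.
by apply: (ub_le_sup (fstar_has_ubound Oz)); exists y.
Qed.

Lemma fstar_ge0 z : Om z -> 0 <= fstar f z.
Proof.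
move=> Oz; have := le_fstar Oz Oz; have d0 := decay_gt0 Oz Oz.
by move=> /(le_trans (normr_ge0 _)); rewrite pmulr_lge0.
Qed.

Lemma fstar_le z K : Om z -> (forall y, Om y -> `|f y| / decay z y <= K) ->
  fstar f z <= K.
Proof.
move=> Oz fK; apply: ge_sup; first by exists (`|f z| / decay z z), z.
by move=> _ [y Oy <-]; exact: fK.
Qed.

Lemma fstar_shift x z : Om x -> Om z -> fstar f z <= decay x z * fstar f x.
Proof.
move=> Ox Oz; apply: fstar_le => // y Oy.
rewrite ler_pdivrMr ?decay_gt0// (le_trans (le_fstar Oy Ox))//.
rewrite mulrC mulrAC ler_wpM2r ?fstar_ge0//; exact: decay_mul.
Qed.

End Function.
End PeetreMaximalFunction.

Section MarcinkiewiczZygmund.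
Context {disp : measure_display} {T : measurableType disp} {R : realType}.
Variables (Om : set T) (dist : T -> T -> R).
Hypothesis mm : measurable_metric Om dist.
Variables (m : {measure set T -> \bar R}) (w : T -> R) (L : R).
Hypothesis dw : doubling Om dist m w L.
Variables (b : nat) (C eta0 : R).
Hypotheses (Lb : 2 * L <= 2 ^+ b) (C0 : 0 < C) (eta00 : 0 < eta0).

Let mO := mm_domain mm.
Let w0 := db_ge0 dw.
Let iw := db_integrable dw.
Let L0 := db_gt0 dw.

Local Notation gball := (gball Om dist).
Local Notation mass := (mass m w).
Local Notation wint := (wint m Om w).

(** Up to doubling, the sum is the integral of a step function on disjoint half balls, itself
    dominated by the decaying kernel about [x]. The factors come from halving the radius ([L]), from
    moving within a ball ([2^b]) and from [decay_wint] ([2^(b+1)]); none depends on [rho]. *)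
Lemma sum_mass_decay r rho s x :
  0 < r -> 0 < rho <= r -> separated Om dist rho s ->
  Om x -> \sum_(z <- s) mass (gball z rho) / decay dist b r z x <=
    L * (2 ^+ b * 2 ^+ b.+1) * mass (gball x r).
Proof.
move=> r0 /andP[rho0 rhor] sep Ox; have [us sO _] := sep.
pose c z := (decay dist b r x z)^-1.
apply: (@le_trans _ _ (L * \sum_(z <- s) c z * mass (gball z (rho / 2)))).
  rewrite mulr_sumr big_seq [leRHS]big_seq; apply: ler_sum => z zs.
  have Oz := sO _ zs.
  rewrite mulrCA mulrC /c (decay_sym mm)// ler_wpM2l//.
    by rewrite invr_ge0 ltW// (decay_gt0 mm).
  rewrite [in leLHS](_ : rho = 2 * (rho / 2)); last by field.
  by apply: (db_doubling dw) => //; rewrite divr_gt0.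
rewrite -mulrA ler_wpM2l ?(ltW L0)//.
rewrite -(wint_separated_sum mm dw c sep); apply: (decay_wint mm dw) => //.
- by apply: wintegrable_sum => //; exact: (gball_wintegrable mm dw).
- move=> y Oy; apply: (separated_at_most_one mm) => //.
    by rewrite divr_ge0// ltW// (decay_gt0 mm b r0 Ox Oy).
  move=> z zs [_ zy]; have Oz := sO _ zs.
  rewrite /c -[leLHS]mul1r ler_pdivrMr ?(decay_gt0 mm)// mulrAC.
  rewrite ler_pdivlMr ?mul1r; last exact: (decay_gt0 mm b r0 Ox Oy).
  apply: (decay_near mm b r0) => //.
  by rewrite (le_trans (ltW zy))// (le_trans _ rhor)// ler_pdivrMr//
    ler_peMr ?(ltW rho0)// ler1n.
Qed.

(** For [u] in the half ball, [|f y| <= |f u| + |f y - f z| + |f u - f z|]. Averaging over [u]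
    leaves the mean of [|f|] and two oscillation terms. *)
Lemma local_average r eta f y z : 0 < r -> 0 < eta -> eta <= eta0 ->
  bounded_measurable Om f ->
  oscillation_bound Om dist b r C eta0 f -> Om y -> Om z ->
    dist z y < eta * r ->
  `|f y| <= wint (fun u => \1_(gball z (eta * r / 2)) u * `|f u|) /
            mass (gball z (eta * r / 2)) + 2 * C * eta * fstar Om dist b r f z.
Proof.
move=> r0 e0 ee0 bf osc Oy Oz zy; have [_ [M fM]] := bf.
have er0 : 0 < eta * r by rewrite mulr_gt0.
have fs0 := fstar_ge0 mm b r0 fM Oz.
set B := gball z _; set K := 2 * C * eta * _.
have B0 : 0 < mass B by apply: (mass_gball_gt0 mm dw) => //; rewrite divr_gt0.
have mB : measurable B by exact: (mm_ball mm).
have bmB := bounded_measurable_indic Om mB (R := R).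
rewrite -lerBlDr ler_pdivlMr// (massE m w (@gball_sub _ _ _ _ _ _ _))
  -wintZ//; last first.
  exact: bounded_measurable_wintegrable.
apply: (le_wint mO w0).
- by apply: wintegrableZ => //; exact: bounded_measurable_wintegrable.
- apply: bounded_measurable_wintegrable => //; apply: bounded_measurableM => //.
  exact: bounded_measurable_norm.
move=> u Ou; rewrite indicE; have [/set_mem[_ zu]|_] := boolP (u \in B);
  last first.
  by rewrite mulr0 mul0r.
rewrite mulr1 mul1r lerBlDl.
have half v : Om v -> dist z v < eta * r ->
  `|f v - f z| <= C * eta * fstar Om dist b r f z.
  move=> Ov zv; rewrite (le_trans (osc _ _ Ov Oz _))//.
    by rewrite (lt_le_trans zv)// ler_pM2r.
  by rewrite ler_wpM2r// ler_wpM2l ?(ltW C0)// ler_pdivrMr// ltW.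
have zu' : dist z u < eta * r by rewrite (lt_trans zu)// ltr_pdivrMr//; lra.
have -> : f y = (f y - f z) + (f u - (f u - f z)) by ring.
rewrite (le_trans (ler_normD _ _))//.
have := ler_normB (f u) (f u - f z); have := half _ Oy zy;
  have := half _ Ou zu'.
rewrite /K; lra.
Qed.

(** An auxiliary net [s'] of mesh [eta * r], with [eta] independent of [rho], bounds [fstar] by a
    decaying sum of local averages; summing first over [s] then costs a constant independent of
    [rho]. *)
Lemma sum_mass_fstar : exists2 C2 : R, 0 < C2 & forall r f rho s, 0 < r ->
  bounded_measurable Om f -> oscillation_bound Om dist b r C eta0 f ->
  0 < rho <= r -> separated Om dist rho s ->
  \sum_(z <- s) mass (gball z rho) * fstar Om dist b r f z <=
    C2 * wint (fun x => `|f x|).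
Proof.
have p0 k : 0 < 2 ^+ k :> R by rewrite exprn_gt0.
(* The first bound allows the oscillation estimate, the second keeps a point within [r] of its net
   point, the third makes the maximal function term at most half of [fs x]. *)
pose eta := Num.min eta0 (Num.min 1 (2 ^+ b.+2 * C)^-1).
have eta_gt0 : 0 < eta by rewrite !lt_min eta00 ltr01 invr_gt0 mulr_gt0.
have eta_eta0 : eta <= eta0 by rewrite ge_min lexx.
have eta1 : eta <= 1 by rewrite !ge_min lexx orbT.
have etaC : 2 ^+ b.+2 * C * eta <= 1.
  have AC0 : 0 < 2 ^+ b.+2 * C by rewrite mulr_gt0.
  rewrite mulrC -[leRHS](mulVf (lt0r_neq0 AC0)) ler_pM2r//.
  by rewrite !ge_min lexx !orbT.
(* With [k] doublings a ball of radius [eta * r / 2] grows to radius at least [r]. *)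
have [k etak] := exists_pow2_ge (2 / eta).
exists (2 ^+ b.+1 * (L * (2 ^+ b * 2 ^+ b.+1)) * L ^+ k).
  by rewrite !mulr_gt0// exprn_gt0.
move=> r f rho s r0 bf osc rhor sep; have [_ [M fM]] := bf.
have er0 : 0 < eta * r by rewrite mulr_gt0.
have [s' sep' cov] := exists_net mm dw er0.
have [us sO _] := sep; have [us' sO' _] := sep'.
pose I z := wint (fun u => \1_(gball z (eta * r / 2)) u * `|f u|).
pose a z := I z / mass (gball z (eta * r / 2)).
have B0 z : Om z -> 0 < mass (gball z (eta * r / 2)).
  by move=> Oz; apply: (mass_gball_gt0 mm dw) => //; rewrite divr_gt0.
have a0 z : Om z -> 0 <= a z.
  move=> Oz; rewrite divr_ge0 ?(ltW (B0 _ Oz))// (wint_ge0 m w0)//.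
pose fs := fstar Om dist b r f.
have fs_le x : Om x -> fs x <= 2 ^+ b.+1 * \sum_(z <- s')
  a z / decay dist b r x z.
  move=> Ox; have fs0 := fstar_ge0 mm b r0 fM Ox.
  (* The half of [fs x] on the right is absorbed on the left; [f] being bounded, [fs x] is a finite
     supremum. *)
  suff : fs x <= 2 ^+ b * (\sum_(z <- s') a z / decay dist b r x z) + fs x / 2.
    by rewrite exprS -mulrA; lra.
  apply: fstar_le => // y Oy; have [z zs' zy] := cov _ Oy; have Oz := sO' _ zs'.
  have dxz := decay_gt0 mm b r0 Ox Oz; have dxy := decay_gt0 mm b r0 Ox Oy.
  have dle : (decay dist b r x y)^-1 <= 2 ^+ b / decay dist b r x z.
    rewrite ler_pdivlMr// ler_pdivrMl// mulrC;
      apply: (decay_near mm b r0) => //.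
    by rewrite (mm_sym mm)// (le_trans (ltW zy))// ler_piMl// ltW.
  have fy := local_average r0 eta_gt0 eta_eta0 bf osc Oy Oz zy.
  have fsz0 := fstar_ge0 mm b r0 fM Oz.
  have K0 : 0 <= a z + 2 * C * eta * fs z.
    by rewrite addr_ge0 ?a0 ?mulr_ge0 ?(ltW C0) ?(ltW eta_gt0).
  apply: (@le_trans _ _ ((a z + 2 * C * eta * fs z)
    * (2 ^+ b / decay dist b r x z))).
    by rewrite ler_pM ?invr_ge0 ?(ltW dxy).
  rewrite mulrDl lerD//.
    rewrite mulrCA ler_pM2l// (bigD1_seq z)//= lerDl big_seq_cond sumr_ge0//
      => u /andP[us'' _].
    by have Ou := sO' _ us''; rewrite divr_ge0 ?a0// ltW// (decay_gt0 mm b r0).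
  rewrite mulrA ler_pdivrMr//.
  (* Passing from [fs z] to [fs x] costs the factor [decay x z], which the denominator cancels. *)
  have := fstar_shift mm b r0 fM Ox Oz; rewrite -/fs => fsz.
  apply: (@le_trans _ _ (2 * C * eta * (decay dist b r x z * fs x) * 2 ^+ b)).
    by rewrite ler_pM2r// ler_wpM2l ?mulr_ge0 ?(ltW C0) ?(ltW eta_gt0).
  rewrite [leLHS](_ : _ = (2 ^+ b.+2 * C * eta)
    * (fs x / 2 * decay dist b r x z)).
    by rewrite ler_piMl// mulr_ge0 ?(ltW dxz)// divr_ge0.
  by rewrite !exprS; field.
have I_le z : Om z -> a z * mass (gball z r) <= L ^+ k * I z.
  move=> Oz; have Bz := B0 _ Oz.
  rewrite /a mulrAC ler_pdivrMr// mulrAC mulrC ler_wpM2r//.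
    by rewrite (wint_ge0 m w0)// => u Ou; rewrite /= mulr_ge0// indicE.
  rewrite (le_trans _ (doubling_iter dw k Oz _)) ?divr_gt0//.
  apply: (mass_gball_mono mm dw) => //; apply: sub_gball.
  have : 1 <= 2 ^+ k * (eta / 2).
    by rewrite -ler_pdivrMr ?divr_gt0// mul1r invf_div.
  have -> : 2 ^+ k * (eta * r / 2) = 2 ^+ k * (eta / 2) * r by field.
  by move=> h; rewrite ler_peMl ?(ltW r0).
have bmI z : z \in s' ->
    wintegrable m Om w (fun u => \1_(gball z (eta * r / 2)) u * `|f u|).
  move=> zs'; apply: bounded_measurable_wintegrable => //.
  apply: bounded_measurableM; last exact: bounded_measurable_norm.
  exact/bounded_measurable_indic/(mm_ball mm)/sO'.
have sumI : \sum_(z <- s') I z <= wint (fun x => `|f x|).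
  rewrite -wint_sum//; apply: (le_wint mO w0).
  - exact: wintegrable_sum.
  - exact/bounded_measurable_wintegrable/bounded_measurable_norm.
  move=> x Ox; under eq_bigr do rewrite mulrC.
  exact: (separated_at_most_one mm (c := fun=> `|f x|)).
set D := L * _.
have D0 : 0 < D by rewrite !mulr_gt0.
apply: (@le_trans _ _ (2 ^+ b.+1 * \sum_(z' <- s')
  a z' * (D * mass (gball z' r)))).
  apply: (@le_trans _ _ (\sum_(z <- s) \sum_(z' <- s')
      2 ^+ b.+1 * (a z' * (mass (gball z rho) / decay dist b r z z')))).
    rewrite big_seq [leRHS]big_seq; apply: ler_sum => z zs; have Oz := sO _ zs.
    apply: (@le_trans _ _ (mass (gball z rho) *
        (2 ^+ b.+1 * \sum_(z' <- s') a z' / decay dist b r z z'))).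
      by rewrite ler_wpM2l ?fs_le// (mass_ge0 _ w0)//; exact: gball_sub.
    rewrite mulrCA !mulr_sumr; apply: ler_sum => z' _.
    by rewrite [_ * (a z' / _)]mulrCA.
  (* After the exchange, the inner sum over [s] is the one bounded by [sum_mass_decay]. *)
  rewrite exchange_big mulr_sumr big_seq [leRHS]big_seq;
    apply: ler_sum => z' zs'.
  have Oz' := sO' _ zs'; rewrite -!mulr_sumr ler_pM2l// ler_wpM2l ?a0//.
  exact: sum_mass_decay.
set W := wint _; have -> :
  2 ^+ b.+1 * D * L ^+ k * W = 2 ^+ b.+1 * (D * (L ^+ k * W)).
  by ring.
rewrite ler_pM2l//.
have -> : \sum_(z' <- s') a z' * (D * mass (gball z' r)) =
    D * \sum_(z' <- s') a z' * mass (gball z' r).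
  by rewrite mulr_sumr; apply: eq_bigr => z' _; rewrite mulrCA.
rewrite ler_pM2l//.
apply: (@le_trans _ _ (\sum_(z' <- s') L ^+ k * I z')).
  by rewrite big_seq [leRHS]big_seq; apply: ler_sum => z' zs'; apply/I_le/sO'.
by rewrite -mulr_sumr ler_pM2l// exprn_gt0.
Qed.

End MarcinkiewiczZygmund.

(** * Positive cubature *)

Section Cubature.
Context {disp : measure_display} {T : measurableType disp} {R : realType}.
Variables (Om : set T) (dist : T -> T -> R).
Hypothesis mm : measurable_metric Om dist.
Variables (m : {measure set T -> \bar R}) (w : T -> R) (L : R).
Hypothesis dw : doubling Om dist m w L.
Variables (b : nat) (C eta0 : R).
Hypotheses (Lb : 2 * L <= 2 ^+ b) (C0 : 0 < C) (eta00 : 0 < eta0).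

Let mO := mm_domain mm.
Let w0 := db_ge0 dw.
Let iw := db_integrable dw.

Local Notation gball := (gball Om dist).
Local Notation mass := (mass m w).
Local Notation wint := (wint m Om w).

Section PartitionOfUnity.
Variables (s : seq T) (rho cd : R).
Hypotheses (sO : forall z, z \in s -> Om z)
  (cov : forall x, Om x -> 1 <= (\sum_(z <- s) \1_(gball z rho) x : R) <= cd).

(** Measurable partition of unity: on the domain, the overlap bounds place it between [1 / cd] times
    the indicator of the ball and the indicator itself. *)
Definition hat (z x : T) : R :=
  \1_(gball z rho) x / \sum_(u <- s) \1_(gball u rho) x.

Lemma hat_bounded_measurable z : z \in s -> bounded_measurable Om (hat z).
Proof.
move=> zs; have bmB u : u \in s -> bounded_measurable Om (\1_(gball u rho) :
  T -> R).
  by move=> us; apply: bounded_measurable_indic; exact/(mm_ball mm)/sO.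
apply: bounded_measurableM; first exact: bmB.
have [mS _] : bounded_measurable Om (fun x =>
  \sum_(u <- s) \1_(gball u rho) x : R).
  exact: bounded_measurable_sum.
split; last first.
  exists 1 => x Ox; have /andP[S1 _] := cov Ox.
  have S0 := lt_le_trans ltr01 S1.
  by rewrite normfV gtr0_norm// invf_le1.
(* The inverse is written as the power [-1] to use the measurability of powers. *)
apply: (eq_measurable_fun (fun x => (\sum_(u <- s) \1_(gball u rho) x :
  R) `^ (-1))).
  move=> x /set_mem Ox; rewrite powR_inv1//.
  by have /andP[S1 _] := cov Ox; exact: le_trans S1.
apply: (measurableT_comp (f := fun y : R => y `^ (-1))) => //.
Qed.

Lemma hat_sum x : Om x -> \sum_(z <- s) hat z x = 1.
Proof.
move=> Ox; rewrite /hat -mulr_suml divff// gt_eqF//.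
by have /andP[S1 _] := cov Ox; exact: lt_le_trans S1.
Qed.

Lemma hat_ge0 z x : 0 <= hat z x.
Proof. by rewrite divr_ge0// ?indicE// sumr_ge0// => u _; rewrite indicE. Qed.

Lemma hat_le z x : Om x -> hat z x <= \1_(gball z rho) x.
Proof.
move=> Ox; rewrite /hat; have /andP[S1 _] := cov Ox.
by rewrite ler_pdivrMr ?(lt_le_trans ltr01)// ler_peMr.
Qed.

Lemma hat_ge z x : Om x -> \1_(gball z rho) x / cd <= hat z x.
Proof.
move=> Ox; rewrite /hat; have /andP[S1 Scd] := cov Ox.
have S0 := lt_le_trans ltr01 S1.
by rewrite ler_wpM2l// lef_pV2// posrE (lt_le_trans S0).
Qed.

Lemma wint_hat_ge z : z \in s -> mass (gball z rho) / cd <= wint (hat z).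
Proof.
move=> zs; have mB := mm_ball mm rho (sO zs).
rewrite (massE m w (@gball_sub _ _ _ _ _ _ _)) mulrC -wintZ//; last first.
  exact: indic_wintegrable.
apply: (le_wint mO w0).
- by apply: wintegrableZ => //; exact: indic_wintegrable.
- by apply: bounded_measurable_wintegrable => //; exact: hat_bounded_measurable.
- by move=> x Ox; rewrite mulrC; exact: hat_ge.
Qed.

Lemma wint_hat_sum f : bounded_measurable Om f ->
  wint f = \sum_(z <- s) wint (fun x => hat z x * f x).
Proof.
move=> bf; rewrite -wint_sum//.
  by apply: eq_wint => x Ox; rewrite -mulr_suml hat_sum// mul1r.
move=> z zs; apply: bounded_measurable_wintegrable => //.
by apply: bounded_measurableM => //; exact: hat_bounded_measurable.
Qed.

(** By the partition of unity the error is the sum of the integrals of [hat z * (f - f z)], each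
    living on the ball about [z]. *)
Lemma hat_quadrature_error f (K : T -> R) : bounded_measurable Om f ->
  (forall z x, z \in s -> gball z rho x -> `|f x - f z| <= K z) ->
  `|wint f - \sum_(z <- s) wint (hat z) * f z| <=
    \sum_(z <- s) mass (gball z rho) * K z.
Proof.
move=> bf fK.
have bb z : z \in s -> bounded_measurable Om (hat z)
  by exact: hat_bounded_measurable.
rewrite wint_hat_sum// -sumrB (le_trans (ler_norm_sum _ _ _))//.
rewrite big_seq [leRHS]big_seq; apply: ler_sum => z zs.
have mB := mm_ball mm rho (sO zs).
rewrite mulrC -mulN1r mulrA mulN1r -wintZ//; last first.
  by apply: bounded_measurable_wintegrable => //; exact: bb.
have ib : wintegrable m Om w (hat z).
  by apply: bounded_measurable_wintegrable => //; exact: bb.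
have ibf : wintegrable m Om w (fun x => hat z x * f x).
  apply: bounded_measurable_wintegrable => //.
  by apply: bounded_measurableM => //; exact: bb.
have ibz : wintegrable m Om w (fun x => - f z * hat z x) by exact: wintegrableZ.
rewrite -wintD//.
have id : wintegrable m Om w (fun x => hat z x * f x + - f z * hat z x).
  exact: wintegrableD.
rewrite (le_trans (le_norm_wint mO w0 id))//.
rewrite (massE m w (@gball_sub _ _ _ _ _ _ _)) mulrC -wintZ//; last first.
  exact: indic_wintegrable.
apply: (le_wint mO w0).
- exact: wintegrable_norm.
- by apply: wintegrableZ => //; exact: indic_wintegrable.
move=> x Ox; rewrite (_ : _ + _ = hat z x * (f x - f z)); last by ring.
rewrite normrM (ger0_norm (hat_ge0 _ _)).
have [xB|xB] := boolP (x \in gball z rho).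
  rewrite mulrC ler_pM ?hat_ge0//; last exact: hat_le.
  by apply: fK => //; exact: set_mem.
by rewrite /hat indicE (negbTE xB) !mul0r mulr0.
Qed.

End PartitionOfUnity.

Lemma positive_cubature : exists2 delta0 : R, 0 < delta0 &
  forall (cd delta r : R) (F : set (T -> R^o)) (s : seq T),
  0 < cd -> 0 < delta < delta0 -> 0 < r -> lin_closed F ->
  (forall f, F f -> bounded_measurable Om f /\
                    oscillation_bound Om dist b r C eta0 f) ->
  separated Om dist (delta * r) s ->
  (forall x, Om x -> 1 <= (\sum_(z <- s) \1_(gball z (delta * r)) x :
    R) <= cd) ->
  exists lam : T -> R,
    (forall z, z \in s -> (2 * cd)^-1 * mass (gball z (delta * r)) <= lam z) /\
    forall f, F f -> wint f = \sum_(z <- s) lam z * f z.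
Proof.
have [C2 C20 mz] := sum_mass_fstar mm dw Lb C0 eta00.
(* The three bounds serve the oscillation estimate, the condition [rho <= r], and a relative
   quadrature error [theta] of at most 1/4. *)
pose delta0 := Num.min eta0 (Num.min 1 (4 * C * C2)^-1).
exists delta0; first by rewrite !lt_min eta00 ltr01 invr_gt0 !mulr_gt0.
move=> cd delta r F s cd0 /andP[d0]; rewrite !lt_min => /and3P[de d1 dC] r0 cF.
move=> bF sep cov; have [us sO _] := sep.
set rho := delta * r.
have rho0 : 0 < rho by rewrite mulr_gt0.
have rhor : 0 < rho <= r by rewrite rho0 ler_piMl// ltW.
pose mu z := wint (hat s rho z).
have mu0 z : 0 <= mu z by rewrite (wint_ge0 m w0)// => x _; exact: hat_ge0.
pose theta := C * delta * C2.
have theta_le : theta <= 4^-1.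
  have h : 4 * C * C2 * delta <= 1.
    have h0 : 0 < 4 * C * C2 by rewrite !mulr_gt0.
    by rewrite -[leRHS](mulfV (lt0r_neq0 h0)) ler_pM2l// ltW.
  by rewrite /theta; lra.
have osc f : F f -> forall z x, z \in s -> gball z rho x ->
    `|f x - f z| <= C * delta * fstar Om dist b r f z.
  move=> Ff z x zs [Ox zx]; have [bf of_] := bF _ Ff; have Oz := sO _ zs.
  have [_ [M fM]] := bf.
  rewrite (le_trans (of_ _ _ Ox Oz _))//.
    by rewrite (lt_trans zx)// /rho ltr_pM2r.
  rewrite ler_wpM2r ?(fstar_ge0 mm b r0 fM)// ler_pM2l//.
  by rewrite ler_pdivrMr// ltW.
have sumK f : F f ->
    \sum_(z <- s) mass (gball z rho) * (C * delta * fstar Om dist b r f z) <=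
    theta * wint (fun x => `|f x|).
  move=> Ff; have [bf of_] := bF _ Ff; have := mz r f rho s r0 bf of_ rhor sep.
  rewrite -(ler_pM2l (mulr_gt0 C0 d0)) mulrA -/theta mulr_sumr => h.
  apply: le_trans h; rewrite le_eqVlt; apply/orP; left; apply/eqP.
  by apply: eq_bigr => z _; rewrite mulrCA.
have err f : F f -> `|wint f - \sum_(z <- s) mu z * f z| <=
    theta * wint (fun x => `|f x|).
  move=> Ff; have [bf _] := bF _ Ff.
  rewrite (le_trans _ (sumK _ Ff))//.
  by apply: (hat_quadrature_error sO cov bf) => z x zs zx; exact: osc.
(* [|f|] oscillates no more than [f], so the same error estimate applies to it, and [theta <= 1/4]
   even gives the factor 4/3. *)
have abs f : F f -> wint (fun x => `|f x|) <= 2 * \sum_(z <- s) mu z * `|f z|.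
  move=> Ff; have [bf _] := bF _ Ff.
  have bnf := bounded_measurable_norm bf.
  have : `|wint (fun x => `|f x|) - \sum_(z <- s) mu z * `|f z| | <=
      theta * wint (fun x => `|f x|).
    rewrite (le_trans _ (sumK _ Ff))//.
    apply: (hat_quadrature_error sO cov bnf) => z x zs zx.
    by rewrite (le_trans (ler_dist_dist _ _))//; exact: osc.
  have W0 : 0 <= wint (fun x => `|f x|) by rewrite (wint_ge0 m w0).
  have : theta * wint (fun x => `|f x|) <= 4^-1 * wint (fun x => `|f x|).
    by rewrite ler_wpM2r.
  rewrite ler_norml => ? /andP[? ?]; lra.
pose Lam f := wint f - 2^-1 * \sum_(z <- s) mu z * f z.
have [//|a f g Ff Fg|f Ff f0|lam [lam0 lamE]] :=
  @farkas R (T -> R^o) T F s (fun z f => f z) Lam cF us.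
- rewrite /Lam.
  have [[bf _] [bg _]] := (bF _ Ff, bF _ Fg).
  have fi := bounded_measurable_wintegrable mO iw bf.
  have gi := bounded_measurable_wintegrable mO iw bg.
  rewrite (_ : wint _ = a * wint f + wint g); last first.
    rewrite -wintZ// -wintD//; first exact: wintegrableZ.
  rewrite (_ : \sum_(z <- s) _ = a * \sum_(z <- s) mu z * f z + \sum_(z <- s)
    mu z * g z).
    by ring.
  by rewrite mulr_sumr -big_split; apply: eq_bigr => z _ /=;
    rewrite mulrDr mulrCA.
(* If [f] is nonnegative on the nodes, with quadrature sum [S], then [int |f| w <= 2 * S]; the error
   is at most [S / 2], so [int f w >= S / 2]. *)
- rewrite /Lam.
  have E : \sum_(z <- s) mu z * `|f z| = \sum_(z <- s) mu z * f z.
    by apply: eq_big_seq => z zs; rewrite ger0_norm// f0.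
  have := abs _ Ff; rewrite E => h.
  have := err _ Ff; rewrite ler_norml => /andP[+ _].
  have : theta * wint (fun x => `|f x|) <= 4^-1 * wint (fun x => `|f x|).
    by rewrite ler_wpM2r// (wint_ge0 m w0).
  lra.
(* The half of the quadrature held back from Farkas' lemma supplies the lower bound on the
   weights. *)
exists (fun z => 2^-1 * mu z + lam z); split => [z zs|f Ff].
  rewrite invfM -mulrA ler_wpDr// ler_pM2l ?invr_gt0// mulrC.
  exact: wint_hat_ge.
have := lamE _ Ff; rewrite /Lam => /eqP; rewrite subr_eq => /eqP ->.
rewrite mulr_sumr -big_split; apply: eq_bigr => z _ /=; ring.
Qed.

End Cubature.

(** * Polynomials and reproducing kernels *)

Section Polynomials.
Variables (R : realType) (d : nat) (Omega : set 'rV[R]_d.+1).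
Local Notation T := 'rV[R]_d.+1.
Local Notation Pi := (@Pi R d Omega).

Lemma Pi_lin_closed n : lin_closed (Pi n : set (T -> R^o)).
Proof.
split.
  exists 0; split; first by rewrite mpoly.mmeasure0.
  by move=> x _; rewrite mpoly.meval0.
move=> a f g [p [pn fp]] [q [qn gq]]; exists (a *: p + q); split.
  rewrite (leq_trans (mpoly.msizeD_le _ _))// geq_max qn andbT.
  exact: leq_trans (mpoly.msizeZ_le _ _) pn.
by move=> x Ox; rewrite mpoly.mevalD mpoly.mevalZ -fp// -gq.
Qed.

Lemma Pi_mono k n : (k <= n)%N -> Pi k `<=` Pi n.
Proof.
by move=> kn f [p [pk fp]]; exists p; split => //; rewrite (leq_trans pk).
Qed.

Lemma Pi_cst n c : Pi n (fun=> c).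
Proof.
exists (mpoly.mpolyC d.+1 c); split; last by move=> x _; rewrite mpoly.mevalC.
by rewrite mpoly.msizeC (leq_trans (leq_b1 _)).
Qed.

(** Terms with zero coefficient may have any degree, which suits sums truncated by a cut-off. *)
Lemma Pi_sum n (I : eqType) (s : seq I) (c : I -> R) (F : I -> T -> R) :
  (forall i, i \in s -> c i != 0 -> Pi n (F i)) ->
  Pi n (fun x => \sum_(i <- s) c i * F i x).
Proof.
elim: s => [|i s IH] FP.
  by under eq_fun do rewrite big_nil; exact: Pi_cst.
have {}IH : Pi n (fun x => \sum_(i <- s) c i * F i x).
  by apply: IH => j js; apply: FP; rewrite inE js orbT.
under eq_fun do rewrite big_cons.
have [->|c0] := eqVneq (c i) 0; first by under eq_fun do rewrite mul0r add0r.
have FPi : Pi n (F i) by apply: FP => //; exact: mem_head.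
exact: (proj2 (Pi_lin_closed n) (c i) _ _ FPi IH).
Qed.

(** [bmultinom d.+1 n.+1] holds the exponents of degree strictly below [n + 1]. The codomain [R^o]
    makes functions into vectors over [R]. *)
Definition monomials n : seq (T -> R^o) :=
  [seq (fun x => mpoly.meval (x 0) (mpoly.mpolyX R (mpoly.bmnm m))) : T -> R^o
  | m <- enum [the finType of mpoly.bmultinom d.+1 n.+1] ].

Lemma Pi_monomials n e : e \in monomials n -> Pi n e.
Proof.
move=> /mapP[m _ ->]; exists (mpoly.mpolyX R (mpoly.bmnm m)); split => //.
by rewrite mpoly.msizeX; exact: mpoly.bmdeg.
Qed.

(** Equality is claimed on [Omega] only, since membership in [Pi] says nothing about values
    elsewhere. *)
Lemma Pi_span n f : Pi n f ->
  exists2 g, span (monomials n) g & forall x, Omega x -> f x = g x.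
Proof.
move=> [p [pn fp]].
pose F (m : mpoly.bmultinom d.+1 n.+1) : T -> R^o :=
  fun x => mpoly.meval (x 0) (mpoly.mpolyX R (mpoly.bmnm m)).
exists (\sum_(m <- enum [the finType of mpoly.bmultinom d.+1 n.+1])
   mpoly.mcoeff (mpoly.bmnm m) p *: F m).
  exact: big_span.
move=> x Ox; rewrite fp// {1}(mpoly.mpolywE pn) raddf_sum/= fct_sumE.
rewrite big_enum /=; apply: eq_bigr => m _.
by rewrite mpoly.mevalZ.
Qed.

End Polynomials.

Section Reproduction.
Variables (R : realType) (d : nat) (Omega : set 'rV[R]_d.+1)
  (mu : {outer_measure set 'rV[R]_d.+1 -> \bar R})
  (dist : 'rV[R]_d.+1 -> 'rV[R]_d.+1 -> R) (varpi : 'rV[R]_d.+1 -> R)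
  (P : nat -> 'rV[R]_d.+1 -> 'rV[R]_d.+1 -> R).
Local Notation T := 'rV[R]_d.+1.
Local Notation Pi := (@Pi R d Omega).
Hypothesis mO : mu.-caratheodory Omega.
Hypothesis ow : orthogonality_weight Omega mu varpi.
Hypothesis hP : forall k, reproducing_kernel Omega mu varpi k (P k).

Local Notation inner := (@inner R d Omega mu varpi).

Lemma inner_wintegrable n k f g : Pi n f -> Pi k g ->
  @wintegrable _ (caratheodory_type mu) R (leb mu) Omega varpi (fun x =>
    f x * g x).
Proof. by move=> nf kg; exact: (ow_integrable ow nf kg). Qed.

Lemma innerC f g : inner f g = inner g f.
Proof. by apply: eq_Rintegral => x _; rewrite (mulrC (f x)). Qed.

Lemma eq_inner f f' g :
  (forall x, Omega x -> f x = f' x) -> inner f g = inner f' g.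
Proof. by move=> ff; apply: eq_Rintegral => x /set_mem Ox; rewrite ff. Qed.

Lemma inner_linear n k f a g h : Pi n f -> Pi k g -> Pi k h ->
  inner f (fun x => a * g x + h x) = a * inner f g + inner f h.
Proof.
move=> nf kg kh.
have ig := inner_wintegrable nf kg; have ih := inner_wintegrable nf kh.
rewrite -[inner f g]/(wint (T :=
  caratheodory_type mu) (leb mu) Omega varpi (fun x => f x * g x)).
rewrite -[inner f h]/(wint (T :=
  caratheodory_type mu) (leb mu) Omega varpi (fun x => f x * h x)).
rewrite -wintZ// -wintD//; last exact: wintegrableZ.
by apply: eq_Rintegral => x _; rewrite mulrDr (mulrCA a).
Qed.

Lemma inner_sum n k f (I : eqType) (s : seq I) (c : I -> R) (F : I -> T -> R) :
  Pi n f -> (forall i, i \in s -> c i != 0 -> Pi k (F i)) ->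
  inner f (fun x => \sum_(i <- s) c i * F i x) = \sum_(i <- s)
    c i * inner f (F i).
Proof.
move=> nf; elim: s => [|i s IH] FP.
  rewrite big_nil /Defs.inner;
    under eq_Rintegral do rewrite big_nil mulr0 mul0r.
  by rewrite Rintegral_cst ?mul0r.
rewrite big_cons -IH => [|j js]; last by apply: FP; rewrite inE js orbT.
have Ps : Pi k (fun x => \sum_(i <- s) c i * F i x).
  by apply: Pi_sum => j js; apply: FP; rewrite inE js orbT.
have [c0|c0] := eqVneq (c i) 0.
  rewrite c0 mul0r add0r; apply: eq_Rintegral => x _; rewrite big_cons c0.
  by rewrite mul0r add0r.
rewrite -(inner_linear _ nf _ Ps); last by apply: FP => //; exact: mem_head.
by apply: eq_Rintegral => x _; rewrite big_cons.
Qed.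

Lemma V_Pi n f : V Omega mu varpi n f -> Pi n f. Proof. by case. Qed.

(** [g] is the orthogonal projection of [f] onto the span of the monomials of degree at most [n];
    definiteness on [Omega] makes polynomials of norm zero orthogonal to everything. *)
Lemma V_decomposition n f : Pi n.+1 f ->
  exists g, Pi n g /\ V Omega mu varpi n.+1 (fun x => f x - g x).
Proof.
move=> nf.
pose S : set (T -> R^o) := Pi n.+1.
have cS : lin_closed S := Pi_lin_closed Omega n.+1.
have monoS e : e \in monomials R d n -> S e.
  by move=> /(Pi_monomials Omega); exact: Pi_mono.
have [|x Sx a y z Sy Sz|x Sx xx y Sy|g gs fg] :=
  orthogonal_projection cS (B := inner) (s := monomials R d n) _ _ _ monoS nf.
- exact: innerC.
- exact: inner_linear Sx Sy Sz.
- rewrite (eq_inner (f' := fun=> 0)); last exact: (ow_definite ow Sx xx).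
  rewrite /Defs.inner; under eq_Rintegral do rewrite !mul0r.
  by rewrite Rintegral_cst ?mul0r.
have ng : Pi n g.
  by apply: sub_span gs; [exact: Pi_lin_closed|exact: Pi_monomials].
exists g; split => //; split.
  have := proj2 cS (-1) g f (Pi_mono (leqnSn n) ng) nf.
  by congr (Pi _ _); apply/funext => x;
    rewrite -[LHS]/(-1 * g x + f x) mulN1r addrC.
move=> k h; rewrite ltnS => kn kh.
have [u us hu] := Pi_span (Pi_mono kn kh).
rewrite innerC (eq_inner _ hu) innerC; exact: fg.
Qed.

(** Induction on the degree with [f = h + g]: the kernels of degree at most [n] kill the top
    component [h], and the kernel of degree [n + 1] kills [g]. *)
Lemma reproduction n f x : Pi n f -> Omega x ->
  f x = \sum_(k < n.+1) inner f (P k x).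
Proof.
move=> + Ox; elim: n f => [|n IH] f nf.
  rewrite big_ord_recl big_ord0 addr0 (proj2 (hP 0))//.
have [g [ng Vh]] := V_decomposition nf; set h := (fun y => f y - g y) in Vh.
have PP k : Pi k (P k x) by have [/(_ _ Ox)] := hP k => /V_Pi.
have nh := V_Pi Vh; have ng' := Pi_mono (leqnSn n) ng.
have split_inner k : inner f (P k x) = inner h (P k x) + inner g (P k x).
  rewrite 3!(innerC _ (P k x)) -[inner _ h]mul1r -(inner_linear 1 (PP k)
    nh ng').
  by apply: eq_Rintegral => y _; rewrite /h mul1r subrK.
rewrite big_ord_recr /= split_inner (proj2 (hP _) _ _ Vh Ox).
rewrite (innerC g) ((proj1 (hP n.+1) _ Ox).2 n g)// addr0.
rewrite (eq_bigr (fun k : 'I_n.+1 => inner g (P k x))) => [|k _].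
  by rewrite -IH// /h addrC subrK.
by rewrite split_inner (Vh.2 k)// add0r.
Qed.

Section CutOffKernel.
Variable a : R -> R.
Hypotheses (a1 : forall t, t <= 1 -> a t = 1) (a2 : forall t, 2 < t -> a t = 0).

Lemma cutoff_vanishes n k : (0 < n)%N -> a (k%:R / n%:R) != 0 -> (k <= 2 * n)%N.
Proof.
move=> n0; apply: contraNT; rewrite -ltnNge => nk; apply/eqP/a2.
by rewrite ltr_pdivlMr ?ltr0n// -natrM ltr_nat.
Qed.

Lemma LkerE n x y : (0 < n)%N ->
  Lker P a n x y = \sum_(k <- iota 0 (2 * n).+1) a (k%:R / n%:R) * P k x y.
Proof.
move=> n0; rewrite /Lker; apply: cvg_lim => //.
apply: cvg_near_cst; exists (2 * n).+1 => // N /= nN.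
rewrite /series /= (big_cat_nat (leq0n _) nN)//= [X in _ + X](_ :
  _ = 0) ?addr0// big_nat big1//.
move=> k /andP[nk _]; rewrite (_ : a _ = 0) ?mul0r//.
apply/eqP; rewrite -[_ == _]negbK; apply/negP => /(cutoff_vanishes n0).
by rewrite leqNgt nk.
Qed.

Lemma Pi_Lker n x : (0 < n)%N -> Omega x -> Pi (2 * n) (Lker P a n x).
Proof.
move=> n0 Ox.
rewrite (_ : Lker P a n x = fun y =>
  \sum_(k <- iota 0 (2 * n).+1) a (k%:R / n%:R) * P k x y).
  apply: Pi_sum => k _ /(cutoff_vanishes n0) kn; apply: (Pi_mono kn).
  by have [/(_ _ Ox)] := hP k => /V_Pi.
by apply/funext => y; exact: LkerE.
Qed.

(** The cut-off is 1 for [k <= n], where the kernels add up to reproduction; for larger [k] the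
    kernel is orthogonal to [f]. *)
Lemma Lker_reproduces n f x : (0 < n)%N -> Pi n f -> Omega x ->
  f x = inner f (Lker P a n x).
Proof.
move=> n0 nf Ox.
rewrite (_ : Lker P a n x = fun y =>
  \sum_(k <- iota 0 (2 * n).+1) a (k%:R / n%:R) * P k x y); last first.
  by apply/funext => y; exact: LkerE.
have PP k : Pi k (P k x) by have [/(_ _ Ox)] := hP k => /V_Pi.
rewrite (inner_sum (k := 2 * n) nf); last first.
  by move=> k _ /(cutoff_vanishes n0) kn; exact: Pi_mono (PP k).
rewrite (reproduction nf Ox) -(big_mkord xpredT (fun k => inner f (P k x))).
have n2 : (n.+1 <= (2 * n).+1)%N by rewrite ltnS leq_pmull.
rewrite -[iota _ _]/(index_iota 0 (2 * n).+1) (big_cat_nat (leq0n _) n2)//=.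
rewrite [X in _ + X](_ : _ = 0) ?addr0; last first.
  rewrite big_nat big1// => k /andP[nk k2].
  suff -> : inner f (P k x) = 0 by rewrite mulr0.
  by rewrite innerC; apply: (proj1 (hP k) _ Ox).2 nf.
rewrite big_nat [RHS]big_nat; apply: eq_bigr => k kn.
by rewrite a1 ?mul1r// ler_pdivrMr ?ltr0n// mul1r ler_nat.
Qed.

End CutOffKernel.
End Reproduction.

(** * Oscillation of polynomials *)

Section PolynomialOscillation.
Variables (R : realType) (d : nat) (Omega : set 'rV[R]_d.+1)
  (mu : {outer_measure set 'rV[R]_d.+1 -> \bar R})
  (dist : 'rV[R]_d.+1 -> 'rV[R]_d.+1 -> R).
Local Notation T := (caratheodory_type mu).

Lemma doubling_metric_domainW : doubling_metric_domain Omega mu dist ->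
  measurable_metric (T := T) Omega dist.
Proof.
case=> -[mO _] [ge0 refl sym tri] mB _ _ _; split => //.
by move=> x Ox; apply/refl.
Qed.

Lemma doubling_weightW w : doubling_weight Omega mu dist w ->
  exists L, doubling (T := T) Omega dist (leb mu) w L.
Proof. by move=> [[w0 iw wO] [L [L0 wL]]]; exists L. Qed.

Variables (varpi : 'rV[R]_d.+1 -> R)
  (P : nat -> 'rV[R]_d.+1 -> 'rV[R]_d.+1 -> R).
Hypothesis hOmega : doubling_metric_domain Omega mu dist.
Hypothesis hvarpi : orthogonality_weight Omega mu varpi.
Hypothesis hP : forall k, reproducing_kernel Omega mu varpi k (P k).
Hypothesis hloc : localizable_homogeneous_space Omega mu dist varpi P.

Let mm := doubling_metric_domainW hOmega.
Let mO : @measurable _ T Omega := mm_domain mm.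
Let cO : mu.-caratheodory Omega := mO.

(** For fixed [n] the balls of radius [1/n] have mass at least some [e > 0], so the kernel is
    bounded by [c / e], and reproduction bounds [f] by its integral norm. *)
Lemma Pi_bounded n f : (0 < n)%N -> Pi Omega n f ->
  exists M, forall x, Omega x -> `|f x| <= M.
Proof.
move=> n0 nf; have [L dv] := doubling_weightW (lhs_doubling hloc).
have [a [aadm a1 a2]] := exists_cutoff R.
have [c [c0 Lc]] := lhs_assertion1 hloc aadm ltr01.
have rn0 : 0 < n%:R^-1 :> R by rewrite invr_gt0 ltr0n.
have [e e0 eB] := mass_gball_lower_bound mm dv rn0.
have iv : @wintegrable _ T R (leb mu) Omega varpi (fun x => `|f x|).
  have := inner_wintegrable hvarpi nf (Pi_cst Omega 0 1).
  under eq_fun do rewrite mulr1.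
  exact: (wintegrable_norm mO (db_ge0 dv)).
exists (c / e * wint (T := T) (leb mu) Omega varpi (fun x => `|f x|)) => x Ox.
rewrite (Lker_reproduces cO hvarpi hP a1 a2 n0 nf Ox) -wintZ//.
have il := inner_wintegrable hvarpi nf (Pi_Lker hP a2 n0 Ox).
rewrite (le_trans (le_norm_wint mO (db_ge0 dv) il))//.
apply: (le_wint mO (db_ge0 dv)).
- exact: (wintegrable_norm mO (db_ge0 dv) il).
- exact: wintegrableZ.
move=> y Oy; rewrite normrM mulrC ler_wpM2r// (le_trans (Lc _ _ _ n0 Ox Oy))//.
rewrite ler_pM2l// lef_pV2 ?posrE//; last first.
  rewrite !mulr_gt0 ?sqrtr_gt0 ?powR_gt0 ?(lt_le_trans e0 (eB _ _))//.
  by rewrite ltr_pwDl// mulr_ge0// (mm_ge0 mm).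
rewrite powRr1; last by rewrite addr_ge0// mulr_ge0// (mm_ge0 mm).
apply: (@le_trans _ _ (Num.sqrt e * Num.sqrt e));
  first by rewrite -expr2 sqr_sqrtr// ltW.
rewrite -[leLHS]mulr1 ler_pM ?mulr_ge0 ?sqrtr_ge0//.
  by rewrite ler_pM ?sqrtr_ge0// ler_wsqrtr// eB.
by rewrite lerDl mulr_ge0// (mm_ge0 mm).
Qed.

(** [f x - f z] is the inner product of [f] with a difference of kernels. There [|f y|] is at most
    [fstar f z * decay z y], and the decay in [assertion2] is taken fast enough to absorb this
    growth and still integrate against [varpi]. *)
Lemma Pi_oscillation b : exists C eta : R, [/\ 0 < C, 0 < eta &
  forall n f, (0 < n)%N -> Pi Omega n f ->
    oscillation_bound (T := T) Omega dist b n%:R^-1 C eta f].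
Proof.
have [L dv] := doubling_weightW (lhs_doubling hloc).
have [a [aadm a1 a2]] := exists_cutoff R.
have [delta0 [/andP[d0 d1] Las]] := lhs_assertion2 hloc aadm.
(* Of the exponent [b + g + 1], the part [b] absorbs the growth of [f], and [g] makes the integral
   against [varpi] converge, [L] being here the doubling constant of [varpi]; the extra 1 keeps the
   exponent positive. *)
have [g Lg] := exists_pow2_ge (2 * L).
have kappa0 : 0 < (b + g).+1%:R :> R by rewrite ltr0n.
have [c [c0 Lc]] := Las _ kappa0.
have L0 := db_gt0 dv.
exists (c * Num.sqrt L * 2 ^+ g.+1), delta0; split => //.
  by rewrite !mulr_gt0 ?sqrtr_gt0// exprn_gt0.
move=> n f n0 nf x z Ox Oz zx.
have rn0 : 0 < n%:R^-1 :> R by rewrite invr_gt0 ltr0n.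
have nn0 : 0 < n%:R :> R by rewrite ltr0n.
have [M fM] := Pi_bounded n0 nf.
set r := n%:R^-1 in zx rn0 *.
have fs0 := fstar_ge0 mm b rn0 fM Oz.
set fs := fstar _ _ _ _ _ _ in fs0 *.
have PL u : Omega u -> Pi Omega (2 * n) (Lker P a n u) := Pi_Lker hP a2 n0.
pose D := fun y => Lker P a n x y - Lker P a n z y.
have PD : Pi Omega (2 * n) D.
  have := proj2 (Pi_lin_closed Omega (2 * n)) (-1) _ _ (PL _ Oz) (PL _ Ox).
  congr (Pi _ _ _); apply/funext => y.
  by rewrite -[LHS]/(-1 * Lker P a n z y + Lker P a n x y) mulN1r addrC.
have fxz : f x - f z = inner Omega mu varpi f D.
  rewrite (Lker_reproduces cO hvarpi hP a1 a2 n0 nf Ox).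
  rewrite (Lker_reproduces cO hvarpi hP a1 a2 n0 nf Oz).
  have := inner_linear cO hvarpi (-1) nf (PL _ Oz) (PL _ Ox).
  rewrite mulN1r addrC => <-; apply: eq_Rintegral => y _.
  by rewrite /D mulN1r (addrC (- _)).
have iD := inner_wintegrable hvarpi nf PD.
rewrite fxz (le_trans (le_norm_wint mO (db_ge0 dv) iD))//.
pose B u := mass (T := T) (leb mu) varpi (gball (T := T) Omega dist u r).
have B0 u : Omega u -> 0 < B u by move=> Ou; exact: (mass_gball_gt0 mm dv).
have dxz : dist x z = dist z x by rewrite (mm_sym mm).
have zx0 : 0 <= dist z x by rewrite (mm_ge0 mm).
pose A := fs * (c * n%:R * dist z x / (Num.sqrt (B x) * Num.sqrt (B z))).
have A0 : 0 <= A by rewrite !mulr_ge0 ?invr_ge0 ?mulr_ge0 ?sqrtr_ge0// ltW.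
apply: (@le_trans _ _ (A * 2 ^+ g.+1 * B z)).
  apply: (decay_wint mm dv Lg Oz rn0 A0).
    exact: (wintegrable_norm mO (db_ge0 dv) iD).
  move=> y Oy; rewrite normrM.
  have t0 : 0 < 1 + dist z y / r.
    by rewrite ltr_pwDl// divr_ge0 ?(mm_ge0 mm)// ltW.
  have := Lc n delta0 x z y n0; rewrite d0 lexx => /(_ erefl Oz) hD.
  have {}hD : `|D y| <= c * n%:R * dist z x /
      (Num.sqrt (B x) * Num.sqrt (B z) * (1 + dist z y / r) ^+ (b + g).+1).
    rewrite -powR_mulrn ?(ltW t0)// /r invrK (mulrC (dist z y)) -dxz.
    by apply: hD => //; split.
  have fy := le_fstar mm b rn0 fM Oy Oz.
  apply: (le_trans (ler_pM _ _ fy hD)) => //.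
  rewrite -/fs /decay /A.
  set t := 1 + _ in t0 *; set q := Num.sqrt _ * _.
  have q0 : 0 < q by rewrite mulr_gt0 ?sqrtr_gt0 ?B0.
  have t1 : 1 <= t by rewrite /t lerDl divr_ge0 ?(mm_ge0 mm)// ltW.
  have -> : fs * t ^+ b * (c * n%:R * dist z x / (q * t ^+ (b + g).+1)) =
    fs * (c * n%:R * dist z x / q) / t ^+ g / t.
    have tb := expf_neq0 b (lt0r_neq0 t0);
      have tg := expf_neq0 g (lt0r_neq0 t0).
    rewrite exprS exprD; field.
    by rewrite tb tg !lt0r_neq0.
  by rewrite ler_pdivrMr// ler_peMr// divr_ge0 ?exprn_ge0 ?(ltW t0).
(* Since [x] is within [r] of [z], doubling gives [B z <= L * B x]; this removes the mixed square
   roots. *)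
have BL : B z <= Num.sqrt L * (Num.sqrt (B x) * Num.sqrt (B z)).
  rewrite mulrA -sqrtrM ?(ltW L0)//.
  have E : B z = Num.sqrt (B z) * Num.sqrt (B z)
    by rewrite -expr2 sqr_sqrtr// ltW// B0.
  rewrite {1}E ler_wpM2r ?sqrtr_ge0//.
  rewrite ler_wsqrtr//; apply: le_trans (db_doubling dv Ox rn0).
  apply: (mass_gball_mono mm dv) => //; apply: sub_gball_shift => //.
  rewrite dxz mulrDl mul1r lerD2r (le_trans (ltW zx))// ler_piMl// ltW//.
rewrite /A -/fs.
have q0 : 0 < Num.sqrt (B x) * Num.sqrt (B z)
  by rewrite mulr_gt0 ?sqrtr_gt0 ?B0.
set q := Num.sqrt (B x) * _ in BL q0 *.
have -> : fs * (c * n%:R * dist z x / q) * 2 ^+ g.+1 * B z =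
  (fs * c * n%:R * dist z x * 2 ^+ g.+1 / q) * B z by ring.
apply: (le_trans (ler_wpM2l _ BL)).
  by rewrite divr_ge0 ?(ltW q0)// !mulr_ge0 ?exprn_ge0// ltW.
rewrite le_eqVlt; apply/orP; left; apply/eqP; rewrite /r invrK; field.
by rewrite lt0r_neq0.
Qed.

(** With [b = 0] the maximal function is bounded by the supremum of [|f|], so the oscillation bound
    becomes a local Lipschitz condition. *)
Lemma Pi_bounded_measurable n f : (0 < n)%N -> Pi Omega n f ->
  bounded_measurable (T := T) Omega f.
Proof.
move=> n0 nf; have [M fM] := Pi_bounded n0 nf; split; last by exists M.
have [L dv] := doubling_weightW (lhs_doubling hloc).
have [C [eta [C0 eta0 osc]]] := Pi_oscillation 0.
have rn0 : 0 < n%:R^-1 :> R by rewrite invr_gt0 ltr0n.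
apply: (lipschitz_measurable mm dv (K := C * n%:R * M) (mulr_gt0 eta0 rn0)).
move=> x z Ox Oz zx; rewrite (le_trans (osc _ _ n0 nf _ _ Ox Oz zx))//.
rewrite invrK -!mulrA ler_pM2l// (mulrC (dist z x)) -!mulrA ler_wpM2l//.
rewrite ler_wpM2r ?(mm_ge0 mm)//; apply: fstar_le => // y Oy.
by rewrite /decay expr0 divr1 fM.
Qed.

End PolynomialOscillation.

(** * Integrals of fast decreasing functions *)

Section FastDecreasing.
Variables (R : realType) (d : nat) (Omega : set 'rV[R]_d.+1)
  (mu : {outer_measure set 'rV[R]_d.+1 -> \bar R})
  (dist : 'rV[R]_d.+1 -> 'rV[R]_d.+1 -> R) (w : 'rV[R]_d.+1 -> R) (L : R).
Local Notation T := (caratheodory_type mu).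
Hypothesis mm : measurable_metric (T := T) Omega dist.
Hypothesis dw : doubling (T := T) Omega dist (leb mu) w L.

(** [decay_wint] gives the mass of the ball of radius [1/n]; [k] doublings compare it with radius
    [delta / n], so [K] depends on [delta] but not on [n] or [z]. *)
Lemma fast_decreasing_wint (b : nat) (gamma c delta : R) : 2 * L <= 2 ^+ b ->
  b%:R <= gamma -> 0 < c -> 0 < delta -> exists2 K : R, 0 < K &
  forall n z (g : 'rV[R]_d.+1 -> R), (0 < n)%N -> Omega z ->
    wintegrable (T := T) (leb mu) Omega w g ->
    (forall y, Omega y -> g y <= c * (1 + n%:R * dist z y) `^ (- gamma)) ->
    wint (T := T) (leb mu)
      Omega w g <= K * wmass mu w (dball Omega dist z (delta / n%:R)).
Proof.
move=> Lb bg c0 d0; have [k dk] := exists_pow2_ge delta^-1.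
have L0 := db_gt0 dw.
exists (c * 2 ^+ b.+1 * L ^+ k); first by rewrite !mulr_gt0// exprn_gt0.
move=> n z g n0 Oz gi gc.
have rn0 : 0 < n%:R^-1 :> R by rewrite invr_gt0 ltr0n.
apply: (@le_trans _ _ (c * 2 ^+ b.+1 *
    mass (T := T) (leb mu) w (gball (T := T) Omega dist z n%:R^-1))).
  apply: (decay_wint mm dw Lb Oz rn0 (ltW c0) gi) => y Oy.
  rewrite (le_trans (gc _ Oy))// invrK (mulrC n%:R) powRN ler_pM2l//.
  have t1 : 1 <= 1 + dist z y * n%:R by rewrite lerDl mulr_ge0// (mm_ge0 mm).
  have t0 := lt_le_trans ltr01 t1.
  rewrite lef_pV2 ?posrE ?powR_gt0 ?exprn_gt0// -powR_mulrn ?(ltW t0)//.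
  exact: ler_powR.
rewrite -[leRHS]mulrA ler_pM2l; last by rewrite mulr_gt0// exprn_gt0.
have dn0 : 0 < delta / n%:R by rewrite divr_gt0 ?ltr0n.
apply: le_trans (doubling_iter dw k Oz dn0).
apply: (mass_gball_mono mm dw) => //; apply: sub_gball.
rewrite mulrA ler_peMl ?(ltW rn0)//.
by rewrite -ler_pdivrMr// div1r.
Qed.

End FastDecreasing.

(** * Cubature on maximal separated sets and size of the weights *)

Theorem theorem2p20 (R : realType) (d : nat) (Omega : set 'rV[R]_d.+1)
    (mu : {outer_measure set 'rV[R]_d.+1 -> \bar R})
    (dist : 'rV[R]_d.+1 -> 'rV[R]_d.+1 -> R)
    (varpi : 'rV[R]_d.+1 -> R) (P : nat -> 'rV[R]_d.+1 -> 'rV[R]_d.+1 -> R)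
    (w : 'rV[R]_d.+1 -> R) (cd : R)
    (hOmega : doubling_metric_domain Omega mu dist)
    (hvarpi : orthogonality_weight Omega mu varpi)
    (hP : forall k, reproducing_kernel Omega mu varpi k (P k))
    (hloc : localizable_homogeneous_space Omega mu dist varpi P)
    (hw : doubling_weight Omega mu dist w)
    (hcd : 1 < cd) :
  exists delta0 c1 : R, 0 < delta0 /\ 0 < c1 /\
  forall delta : R, 0 < delta < delta0 ->
  exists c' c : R, 0 < c' /\ 0 < c /\
  forall n : nat, (0 < n)%N ->
  forall Xi : set 'rV[R]_d.+1,
    maximal_separated Omega dist cd (delta / n%:R) Xi ->
  finite_set Xi /\
  exists lambda : 'rV[R]_d.+1 -> R,
    [/\ forall z, Xi z -> 0 < lambda z,
        forall f, Pi Omega n f ->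
          (\int[leb mu]_(x in Omega) (f x * w x)%:E =
           (\sum_(z \in Xi) lambda z * f z)%:E)%E,
        forall z, Xi z ->
          c1 * wmass mu w (dball Omega dist z (delta / n%:R)) <= lambda z &
        assertion4 Omega dist -> forall z, Xi z ->
          c' * lambda z <= wmass mu w (dball Omega dist z (delta / n%:R))
            <= c * lambda z].
Proof.
pose T := (caratheodory_type mu : measurableType _).
have mm := doubling_metric_domainW hOmega.
have mO : @measurable _ T Omega := mm_domain mm.
have [L dw] := doubling_weightW hw.
have [b Lb] := exists_pow2_ge (2 * L).
have [C [eta [C0 eta0 osc]]] := Pi_oscillation hOmega hvarpi hP hloc b.
have bm n f : (0 < n)%N -> Pi Omega n f -> bounded_measurable (T := T) Omega f.
  exact: (Pi_bounded_measurable hOmega hvarpi hP hloc).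
have [delta0 d00 cub] := positive_cubature mm dw Lb C0 eta0.
have cd0 : 0 < cd by rewrite (lt_trans ltr01).
exists delta0, (2 * cd)^-1; split => //; split.
  by rewrite invr_gt0 mulr_gt0.
move=> delta dlt; have /andP[d0 _] := dlt.
(* [K] has to be fixed before [n] and [Xi], whereas [assertion4] is assumed only for the last claim;
   hence the case distinction, with the dummy value 1 when it fails. *)
have [K K0 fastK] : exists2 K : R, 0 < K & assertion4 Omega dist ->
    forall n z, (0 < n)%N -> Omega z -> exists g, [/\ Pi Omega n g, g z = 1,
      forall y, Omega y -> 0 <= g y &
      wint (T := T) (leb mu)
        Omega w g <= K * wmass mu w (dball Omega dist z (delta / n%:R))].
  have [a4|na4] := pselect (assertion4 Omega dist); last by exists 1.
  have [_ [fast [fP _ fdec _]]] := a4.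
  (* The exponent [b + 2] is above 1 even for [b = 0], and at least [b]. *)
  have gamma1 : 1 < b.+2%:R :> R by rewrite ltr1n.
  have [c [c0 fc]] := fdec _ gamma1.
  have bg : b%:R <= b.+2%:R :> R by rewrite ler_nat leqW.
  have [K K0 hK] := fast_decreasing_wint mm dw Lb bg c0 d0.
  exists K => // _ n z n0 Oz; have [nf fz f0] := fP n z n0 Oz.
  exists (fast n z); split => //; apply: hK => //.
    exact: (bounded_measurable_wintegrable mO (db_integrable dw)
      (bm _ _ n0 nf)).
  by move=> y Oy; exact: fc.
(* [K] bounds the weights from above through the fast decreasing polynomials; [2 * cd] restates the
   lower bound of the cubature. *)
exists K^-1, (2 * cd); rewrite invr_gt0 mulr_gt0//; split => //; split => //.
move=> n n0 Xi [XO sep cov].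
have rn0 : 0 < n%:R^-1 :> R by rewrite invr_gt0 ltr0n.
have fXi : finite_set Xi.
  by apply: (separated_set_finite mm dw _ XO sep); rewrite mulr_gt0.
split => //.
pose s : seq T := finmap.enum_fset (fset_set Xi).
have sE z : (z \in s) = (z \in Xi) by exact: in_fset_set.
have sXi z : z \in s -> Xi z by rewrite sE => /set_mem.
have ssep : separated (T := T) Omega dist (delta * n%:R^-1) s.
  split => [|z /sXi /XO//|x y /sXi Xx /sXi Xy]; first exact: finmap.fset_uniq.
  exact: sep.
have scov x : Omega x ->
    1 <= (\sum_(z <- s) \1_(gball (T :=
      T) Omega dist z (delta * n%:R^-1)) x : R) <= cd.
  move=> Ox; have := cov _ Ox; rewrite esum_fset; last 2 first.
  - exact: fXi.
  - by move=> z _; rewrite lee_fin indicE.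
  rewrite fsbig_finite; last exact: fXi.
  rewrite sumEFin !lee_fin => h.
  exact h.
have [|lam [lam_ge lamE]] :=
  cub cd delta n%:R^-1 (Pi Omega n) s cd0 dlt rn0 (Pi_lin_closed Omega n)
  _ ssep scov.
  by move=> f nf; split; [exact: bm nf|exact: osc].
have lam_gt0 z : Xi z -> 0 < lam z.
  move=> Xz; apply: lt_le_trans (lam_ge z _); last by rewrite sE mem_set.
  rewrite mulr_gt0 ?invr_gt0 ?mulr_gt0//.
  by apply: (mass_gball_gt0 mm dw); [exact: XO|rewrite mulr_gt0].
exists lam; split => //.
- move=> f nf.
  have fi := bounded_measurable_wintegrable mO (db_integrable dw)
    (bm _ _ n0 nf).
  rewrite -[LHS]fineK; last exact: (integrable_fin_num mO fi).
  congr EFin; rewrite -[LHS]/(wint (T := T) (leb mu) Omega w f) lamE//.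
  by rewrite fsbig_finite.
- by move=> z Xz; apply: lam_ge; rewrite sE mem_set.
- move=> a4 z Xz; have Oz := XO _ Xz; have zs : z \in s by rewrite sE mem_set.
  apply/andP; split; last first.
    by rewrite -ler_pdivrMl ?mulr_gt0// lam_ge.
  (* As [g z = 1] and all terms are nonnegative, [lam z] is at most the cubature sum of [g], which
     is its integral. *)
  have [g [ng gz g0 gK]] := fastK a4 n z n0 Oz.
  rewrite ler_pdivrMl//; apply: le_trans gK.
  rewrite lamE// (bigD1_seq z)//=; last exact: finmap.fset_uniq.
  rewrite gz mulr1 lerDl big_seq_cond sumr_ge0// => u /andP[/sXi Xu _].
  by rewrite mulr_ge0 ?g0 ?(ltW (lam_gt0 _ Xu))//; exact: XO.
Qed.
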